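(* Let $A$ be a rooted directed tree and let $1<p<\infty$. Then $A$ admits a mixing (bounded) weighted backward shift $B_\lambda:\ell^p(A)\to\ell^p(A)$ with no hypercyclic algebra if, and only if, $A$ has a fertile vertex.
   Context: All scalars are complex. A directed tree is a connected directed graph $(A,E)$ with countable vertex set $A$ and edge set $E\subset\{(a,b)\in A\times A: a\ne b\}$, having no cycles, and such that each vertex $b$ has at most one parent, i.e. a vertex $a$ with $(a,b)\in E$. There is at most one vertex without a parent, called the root; the tree is rooted if it has a root. $\mathrm{Chi}(v)$ is the set of children of $v$ (vertices whose parent is $v$), $\mathrm{Chi}^0(v)=\{v\}$, $\mathrm{Chi}^n(v)=\bigcup_{u\in\mathrm{Chi}^{n-1}(v)}\mathrm{Chi}(u)$. All trees are assumed leafless: every vertex has at least one child (possibly infinitely many). A vertex $v_0\in A$ is fertile if, for every $v\in\bigcup_{n\in\mathbb{N}}\mathrm{Chi}^n(v_0)$, the cardinality $|\mathrm{Chi}^n(v)|$ tends to $+\infty$ as $n\to+\infty$ (with the convention $|\mathrm{Chi}^n(v)|=+\infty$ if this set is infinite). A weight is a family $\lambda=(\lambda_v)_{v\in A}$ of non-zero scalars. The weighted backward shift is $(B_\lambda f)(v)=\sum_{u\in\mathrm{Chi}(v)}\lambda_uf(u)$ for $f\in\mathbb{C}^A$, $v\in A$. $\ell^p(A)$ is the space of $f\in\mathbb{C}^A$ with $\|f\|_p=(\sum_{v\in A}|f(v)|^p)^{1/p}<\infty$; it is a Banach algebra for the coordinatewise product $(fg)(v)=f(v)g(v)$. A bounded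 operator $T$ on $X$ is mixing if for all non-empty open $U,W\subset X$ there is $N\ge 0$ with $T^k(U)\cap W\ne\varnothing$ for all $k\ge N$. A hypercyclic vector of $T$ is a vector $x$ whose orbit $\{T^nx:n\ge0\}$ is dense. A hypercyclic algebra for $T$ is a subalgebra, not $\{0\}$, all of whose non-zero elements are hypercyclic vectors of $T$. *)

(* Defs.v *)
From HB Require Import structures.
From mathcomp Require Import all_boot all_order all_algebra.
From mathcomp Require Import all_classical all_reals all_analysis.
From mathcomp Require Import ring lra.
From mathcomp Require Import complex.
From mathcomp.analysis.showcase Require summability.

Set Implicit Arguments.
Unset Strict Implicit.
Unset Printing Implicit Defensive.

Import Order.TTheory GRing.Theory Num.Theory.
Import numFieldNormedType.Exports.
Import ComplexField.Normc.

Local Open Scope classical_set_scope.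
Local Open Scope card_scope.
Local Open Scope ring_scope.
Local Open Scope complex_scope.

Section DirectedTree.
Variables (A : countType) (E : rel A).

Definition directed_connected : Prop :=
  forall a b, exists s : seq A,
    path (fun x y => E x y || E y x) a s /\ last a s = b.

(* Since every vertex has at most one parent, a cycle of the underlying
   undirected graph would be a directed one, so it is enough to exclude
   directed cycles (of any length; length one says that E is irreflexive). *)
Definition acyclic : Prop := forall c : seq A, c != [::] -> ~~ cycle E c.

Definition directed_tree : Prop :=
  [/\ directed_connected,
      (forall a b, E a b -> a != b),
      acyclic
    & forall a a' b, E a b -> E a' b -> a = a'].

Definition is_root (r : A) : Prop := forall a, ~~ E a r.

Definition rooted : Prop := exists r, is_root r.

Definition leafless : Prop := forall v, exists u, E v u.

Definition Chi (v : A) : set A := [set u | E v u].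

Fixpoint Chin (n : nat) (v : A) : set A :=
  if n is m.+1 then \bigcup_(u in Chin m v) Chi u else [set v].

(* The divergence |Chi^n(v)| --> +oo, where an infinite set counts as +oo:
   for every K, eventually Chi^n(v) has at least K elements. *)
Definition fertile (v0 : A) : Prop :=
  forall v, (\bigcup_n Chin n v0) v ->
    forall K : nat, \forall n \near \oo, `I_K #<= Chin n v.

End DirectedTree.

Section EsumScale.
Context {R : realType} {T : choiceType}.
Implicit Types (S : set T) (a : T -> R).

Lemma le_esumZl S (k : R) a : 0 <= k -> (forall t, 0 <= a t) ->
  (\esum_(t in S) (k * a t)%:E <= k%:E * \esum_(t in S) (a t)%:E)%E.
Proof.
move=> k0 a0; apply: ge_ereal_sup => _ [F [finF FS] <-].
under eq_fsbigr do rewrite EFinM.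
rewrite -ge0_mule_fsumr; last by move=> t; rewrite lee_fin.
by apply: lee_wpmul2l; [rewrite lee_fin|apply: ereal_sup_ubound; exists F].
Qed.

Lemma esumZl S (k : R) a : 0 <= k -> (forall t, 0 <= a t) ->
  (\esum_(t in S) (k * a t)%:E = k%:E * \esum_(t in S) (a t)%:E)%E.
Proof.
move=> k0 a0; have [->|kN0] := eqVneq k 0.
  by rewrite mul0e esum1// => t _; rewrite mul0r.
have kp : 0 < k by rewrite lt_def kN0.
apply/eqP; rewrite eq_le le_esumZl//=.
rewrite -lee_pdivlMl//.
have := @le_esumZl S k^-1 (fun t => k * a t).
under eq_esum do rewrite mulrA mulVf// mul1r.
by apply; [rewrite invr_ge0|move=> t; rewrite mulr_ge0].
Qed.

Lemma le_esum_term S a t : (forall t, 0 <= a t) -> S t ->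
  ((a t)%:E <= \esum_(t in S) (a t)%:E)%E.
Proof.
move=> a0 St; apply: esum_ge; exists [set t].
  by split => // _ ->.
by rewrite fsbig_set1.
Qed.

End EsumScale.

Section PowerConvexity.
Context {R : realType}.
Implicit Types x y a b p : R.

Lemma powR_add_le p a b x y : 1 <= p -> 0 < a -> 0 < b -> 0 <= x -> 0 <= y ->
  (x + y) `^ p <= (a + b) `^ p *
    (a / (a + b) * (x / a) `^ p + b / (a + b) * (y / b) `^ p).
Proof.
move=> p1 a0 b0 x0 y0.
have ab0 : 0 < a + b by rewrite addr_gt0.
have t0 : 0 <= a / (a + b) by rewrite divr_ge0 // ltW.
have t1 : a / (a + b) <= 1 by rewrite ler_pdivrMr// mul1r lerDl ltW.
have xa0 : 0 <= x / a by rewrite divr_ge0 // ltW.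
have yb0 : 0 <= y / b by rewrite divr_ge0 // ltW.
have eb : b / (a + b) = 1 - a / (a + b).
  by field; rewrite gt_eqF.
have cvx : (a / (a + b) * (x / a) + b / (a + b) * (y / b)) `^ p <=
    a / (a + b) * (x / a) `^ p + b / (a + b) * (y / b) `^ p.
  rewrite eb; apply: (convex_powR p1 (Itv01 t0 t1)) => //=.
    by rewrite inE/= in_itv/= xa0.
  by rewrite inE/= in_itv/= yb0.
have -> : x + y = (a + b) * (a / (a + b) * (x / a) + b / (a + b) * (y / b)).
  by field; rewrite !gt_eqF.
rewrite powRM ?(ltW ab0)//; last first.
  by rewrite addr_ge0 // mulr_ge0 // eb subr_ge0.
by rewrite ler_wpM2l ?powR_ge0.
Qed.

End PowerConvexity.

Section LpSum.
Context {R : realType} {A : countType} (p : R) (hp : 1 < p).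
Implicit Types f g : A -> R[i].

Definition lp_sum f : \bar R := (\esum_(v in [set: A]) (normc (f v) `^ p)%:E)%E.

Definition lp_norm f : R := fine (lp_sum f) `^ p^-1.

Let p1 : 1 <= p. Proof. exact: ltW. Qed.
Let p0 : 0 < p. Proof. exact: lt_trans hp. Qed.
Let pN0 : p != 0. Proof. by rewrite gt_eqF. Qed.

Lemma normc_ge0 (z : R[i]) : 0 <= normc z.
Proof. by case: z => a b; rewrite sqrtr_ge0. Qed.

Lemma lp_sum_ge0 f : (0 <= lp_sum f)%E.
Proof. by apply: esum_ge0 => v _; rewrite lee_fin powR_ge0. Qed.

Lemma lp_sumZ (c : R[i]) f :
  lp_sum (fun v => c * f v) = ((normc c `^ p)%:E * lp_sum f)%E.
Proof.
rewrite /lp_sum -esumZl ?powR_ge0//; last by move=> ?; rewrite powR_ge0.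
by apply: eq_esum => v _; rewrite normcM powRM ?normc_ge0.
Qed.

Lemma lp_sum_add_le f g (a b : R) : 0 < a -> 0 < b ->
  (lp_sum (f \+ g)%R <= ((a + b) `^ p * (a / (a + b) / a `^ p))%:E * lp_sum f +
                      ((a + b) `^ p * (b / (a + b) / b `^ p))%:E * lp_sum g)%E.
Proof.
move=> a0 b0.
have ab0 : 0 < a + b by rewrite addr_gt0.
have k0 (c : R) : 0 < c -> 0 <= (a + b) `^ p * (c / (a + b) / c `^ p).
  by move=> c0; rewrite mulr_ge0 ?powR_ge0// !divr_ge0 ?powR_ge0// ltW.
have q0 f' v : 0 <= normc (f' v : R[i]) `^ p by rewrite powR_ge0.
rewrite /lp_sum -!esumZl ?k0//; try exact: q0.
rewrite -esumD; try by move=> v _; rewrite lee_fin mulr_ge0 ?k0 ?q0.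
apply: le_esum => v _; rewrite -EFinD lee_fin.
apply: le_trans (_ : (normc (f v) + normc (g v)) `^ p <= _).
  rewrite ge0_ler_powR ?nnegrE ?(ltW p0) ?normc_ge0 ?addr_ge0 ?normc_ge0//.
  exact: le_normcD.
apply: le_trans (powR_add_le p1 a0 b0 (normc_ge0 _) (normc_ge0 _)) _.
rewrite !powRM ?normc_ge0 ?invr_ge0 ?(ltW a0) ?(ltW b0)//.
have powRV (c : R) : 0 < c -> c^-1 `^ p = (c `^ p)^-1.
  by move=> c0; rewrite -powR_inv1 ?ltW// -powRrM mulN1r powRN.
rewrite !powRV//.
by rewrite le_eqVlt; apply/orP; left; apply/eqP; ring.
Qed.

Lemma lp_sumD f g : (lp_sum f < +oo)%E -> (lp_sum g < +oo)%E ->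
  (lp_sum (f \+ g)%R < +oo)%E.
Proof.
move=> f_fin g_fin.
apply: le_lt_trans (lp_sum_add_le f g ltr01 ltr01) _.
by rewrite lte_add_pinfty// lte_mul_pinfty// ?lee_fin ?mulr_ge0 ?powR_ge0//;
  rewrite !divr_ge0 ?powR_ge0.
Qed.

Lemma lp_sumM f g : (lp_sum f < +oo)%E -> (lp_sum g < +oo)%E ->
  (lp_sum (f \* g)%R < +oo)%E.
Proof.
move=> f_fin g_fin; set M := fine (lp_sum g).
have gM : lp_sum g = M%:E by rewrite fineK// ge0_fin_numE// lp_sum_ge0.
have M0 : 0 <= M by rewrite fine_ge0// lp_sum_ge0.
apply: (@le_lt_trans _ _ (M%:E * lp_sum f)%E); last first.
  by rewrite lte_mul_pinfty.
rewrite /lp_sum -esumZl//; last by move=> ?; rewrite powR_ge0.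
apply: le_esum => v _; rewrite lee_fin normcM powRM ?normc_ge0//.
rewrite mulrC ler_wpM2r ?powR_ge0// -lee_fin -gM.
by apply: (@le_esum_term _ _ _ (fun v => normc (g v) `^ p)) => // ?; rewrite powR_ge0.
Qed.

Lemma lp_norm_ge0 f : 0 <= lp_norm f. Proof. exact: powR_ge0. Qed.

Lemma lp_norm_powR f : (lp_sum f < +oo)%E -> (lp_norm f `^ p)%:E = lp_sum f.
Proof.
move=> f_fin; have f0 := lp_sum_ge0 f.
by rewrite /lp_norm -powRrM mulVf// powRr1 ?fine_ge0// fineK// ge0_fin_numE.
Qed.

Lemma lp_norm_eq0 f : (lp_sum f < +oo)%E -> lp_norm f = 0 -> f =1 (fun=> 0).
Proof.
move=> f_fin f0 v; apply: (@eq0_normc R).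
have : ((normc (f v) `^ p)%:E <= lp_sum f)%E.
  by apply: (@le_esum_term _ _ _ (fun v => normc (f v) `^ p)) => // ?; rewrite powR_ge0.
rewrite -lp_norm_powR// f0 powR0// lee_fin => fv0.
apply/(@powR_eq0_eq0 _ _ p)/eqP.
by rewrite eq_le fv0 powR_ge0.
Qed.

Lemma lp_normZ (c : R[i]) f : (lp_sum f < +oo)%E ->
  lp_norm (fun v => c * f v) = normc c * lp_norm f.
Proof.
move=> f_fin.
have f_num : lp_sum f \is a fin_num by rewrite ge0_fin_numE// lp_sum_ge0.
rewrite /lp_norm lp_sumZ fineM//= powRM ?powR_ge0// ?fine_ge0 ?lp_sum_ge0//.
by rewrite -powRrM mulfV// powRr1// normc_ge0.
Qed.

Lemma lp_normD f g : (lp_sum f < +oo)%E -> (lp_sum g < +oo)%E ->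
  lp_norm (f \+ g) <= lp_norm f + lp_norm g.
Proof.
move=> f_fin g_fin.
suff main a b : lp_norm f < a -> lp_norm g < b -> lp_norm (f \+ g) <= a + b.
  apply/ler_addgt0Pr => e e0.
  have e20 : 0 < e / 2 by rewrite divr_gt0.
  have lt_half x : x < x + e / 2 by rewrite ltrDl.
  rewrite [in leRHS](splitr e) addrACA.
  exact: main (lt_half _) (lt_half _).
move=> fa gb.
have a0 : 0 < a by exact: le_lt_trans (lp_norm_ge0 f) fa.
have b0 : 0 < b by exact: le_lt_trans (lp_norm_ge0 g) gb.
have ab0 : 0 < a + b by rewrite addr_gt0.
have := lp_sum_add_le f g a0 b0.
have fg_fin := lp_sumD f_fin g_fin.
have {f_fin} fE := lp_norm_powR f_fin; have {g_fin} gE := lp_norm_powR g_fin.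
have {fg_fin} fgE := lp_norm_powR fg_fin.
rewrite -{}fE -{}gE -{}fgE -!EFinM -EFinD lee_fin => fg.
have {}fg : lp_norm (f \+ g) `^ p <= (a + b) `^ p.
  apply: le_trans fg _.
  rewrite [leRHS](_ : _ = (a + b) `^ p * (a / (a + b) + b / (a + b))); last first.
    by rewrite -mulrDl divff ?mulr1// gt_eqF.
  have le_term (c t : R) : 0 < c -> 0 <= t -> t < c ->
      (a + b) `^ p * (c / (a + b) / c `^ p) * t `^ p <=
      (a + b) `^ p * (c / (a + b)).
    move=> c0 t0 tc; rewrite -mulrA ler_wpM2l ?powR_ge0//.
    rewrite -mulrA ler_piMr ?divr_ge0 ?(ltW c0) ?(ltW ab0)//.
    rewrite mulrC ler_pdivrMr ?powR_gt0// mul1r.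
    by rewrite ge0_ler_powR ?nnegrE ?(ltW p0) ?(ltW c0) ?(ltW tc).
  by rewrite mulrDr lerD// le_term ?lp_norm_ge0.
rewrite leNgt; apply/negP => ltfg; move: fg; apply/negP; rewrite -ltNge.
by rewrite gt0_ltr_powR ?nnegrE ?lp_norm_ge0 ?(ltW ab0).
Qed.

Definition lp_pred of 1 < p : {pred A -> R[i]} := [pred f | (lp_sum f < +oo)%E].

Lemma lp_pred_submod : submod_closed (lp_pred hp).
Proof.
split=> [|c f g]; rewrite !inE.
  by rewrite /lp_sum esum1// => v _; rewrite normc0 powR0.
move=> f_fin g_fin; apply: lp_sumD => //.
rewrite [lp_sum _](lp_sumZ c f).
by rewrite lte_mul_pinfty// lee_fin powR_ge0.
Qed.

HB.instance Definition _ :=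
  GRing.isSubmodClosed.Build R[i] (A -> R[i]) (lp_pred hp) lp_pred_submod.

End LpSum.

Section LpSpace.
Context (R : realType) (A : countType) (p : R) (hp : 1 < p).

Record lp : predArgType := Lp {
  lp_fun :> A -> R[i];
  lp_funP : lp_fun \in lp_pred hp }.

HB.instance Definition _ := [isSub for lp_fun].
HB.instance Definition _ := [Choice of lp by <:].
HB.instance Definition _ := [SubChoice_isSubLmodule of lp by <:].

Lemma lp_fin (f : lp) : (lp_sum p f < +oo)%E.
Proof. by have := lp_funP f; rewrite inE. Qed.

(* Norms of complex normed modules take their values in [R[i]]. *)
Let normC (f : lp) : R[i] := (lp_norm p f)%:C.

Let normC_triangle (f g : lp) : normC (f + g) <= normC f + normC g.
Proof.
by rewrite /normC -rmorphD /= lecR; apply: lp_normD; rewrite ?lp_fin.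
Qed.

Let normCZ (c : R[i]) (f : lp) : normC (c *: f) = `|c| * normC f.
Proof.
by rewrite /normC [lp_norm _ _]lp_normZ ?lp_fin// rmorphM.
Qed.

Let normC_eq0 (f : lp) : normC f = 0 -> f = 0.
Proof.
move=> /eqP; rewrite /normC (fmorph_eq0 (real_complex R)) => /eqP f0.
apply/val_inj/funext => v /=.
by rewrite (lp_norm_eq0 hp (lp_fin f) f0).
Qed.

HB.instance Definition _ :=
  Lmodule_isNormed.Build R[i] lp normC_triangle normCZ normC_eq0.

Lemma lp_normE (f : lp) : `|f| = (lp_norm p f)%:C. Proof. by []. Qed.

Lemma lp_mulP (f g : lp) : (fun v => f v * g v) \in lp_pred hp.
Proof. by rewrite inE; apply: lp_sumM; rewrite ?lp_fin. Qed.

Definition lp_mul (f g : lp) : lp := Lp (lp_mulP f g).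

End LpSpace.

Arguments lp {R} A {p} hp.

Definition weight {R : realType} {A : countType} (lam : A -> R[i]) : Prop :=
  forall v, lam v != 0.

(* [T] acts on [lp] as B_lam.  The (possibly infinite) sum over Chi(v) is the
   unconditional one: the limit of the sums over finite sets of children, along
   the directed set of finite subsets of [A]. *)
Definition is_backward_shift {R : realType} {A : countType} {p : R} {hp : 1 < p}
    (E : rel A) (lam : A -> R[i]) (T : lp A hp -> lp A hp) : Prop :=
  forall (f : lp A hp) (v : A),
    summability.partial_sum
        (patch (fun=> 0) (Chi E v) (fun u => lam u * f u : R[i]^o)) @
      summability.totally --> (T f v : R[i]^o).

Section Dynamics.
Context {R : realType} {A : countType} {p : R} {hp : 1 < p}.
Local Notation X := (lp A hp).
Implicit Types T : X -> X.

Definition bounded_operator T : Prop :=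
  linear T /\ exists M : R, forall f, `|T f| <= M%:C * `|f|.

Definition mixing T : Prop :=
  forall U W : set X, open U -> U !=set0 -> open W -> W !=set0 ->
    exists N, forall k, (N <= k)%N -> (iter k T @` U) `&` W !=set0.

Definition hypercyclic_vector T (x : X) : Prop :=
  dense [set iter n T x | n in [set: nat]].

Definition subalgebra (S : set X) : Prop :=
  [/\ S 0,
      forall f g, S f -> S g -> S (f + g),
      forall (c : R[i]) f, S f -> S (c *: f)
    & forall f g, S f -> S g -> S (lp_mul f g)].

Definition hypercyclic_algebra T (S : set X) : Prop :=
  [/\ subalgebra S, S != [set 0]
    & forall f, S f -> f != 0 -> hypercyclic_vector T f].

End Dynamics.

(* Main.v *)
Require Import Defs.
From HB Require Import structures.
From mathcomp Require Import all_boot all_order all_algebra.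
From mathcomp Require Import all_classical all_reals all_analysis.
From mathcomp Require Import finmap complex.
From mathcomp Require Import ring lra zify.

(** Let [Lam v] be the product of the weights along the path from the root to
    [v]. The [n]-th iterate of the shift maps [delta u] to
    [(Lam u / Lam v) *: delta v] for [u] in the [n]-th generation of [v], and it
    kills the first [n] generations. Hence the shift is mixing as soon as every
    [delta v] has small preimages under all late iterates
    ([mixing_of_liftable]). There are two sources of small preimages: a single
    vertex with a large cumulative weight ([lift_ray]), or the average of many
    vertices with a bounded cumulative weight ([lift_average]), which works
    because [p > 1]. The second one is of no help to powers of an element: a high
    power of an element of the space is absolutely summable, and bounded
    cumulative weights keep its orbit bounded at a vertex.

    If [v0] is fertile, the weights are chosen so that the cumulative weights
    are at most 1 under [v0] ([fertile_mass]). No algebra can then be hypercyclic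
    ([no_hypercyclic_algebra]). Yet below every descendant of [v0] they equal 1 on a
    subtree that branches over and over again, so that its generations grow
    ([branching_growth]) and averages over them give mixing ([liftable_all]).

    If no vertex is fertile, every vertex has a descendant below which the tree
    is a single ray ([barren_descendant]), and mixing forces the cumulative
    weights to tend to infinity along this ray ([barren_ray_escapes]). The shift
    then behaves like a weighted shift on the natural numbers, and one vector
    generates a hypercyclic algebra. This vector is a sum of blocks at deeper and
    deeper levels. The [k]-th block is carried by these rays and its
    entries are [d]-th roots, chosen such that the [time k]-th iterate of its
    [d]-th power is the [k]-th vector of a dense sequence of targets. Iterating a
    polynomial of the generator whose lowest degree is [d], the contributions of
    the higher powers, of the earlier and of the later blocks are negligible
    ([orbit_near_target]). *)

Set Implicit Arguments.
Unset Strict Implicit.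
Unset Printing Implicit Defensive.

Import Order.TTheory GRing.Theory Num.Theory.
Import numFieldNormedType.Exports.
Import ComplexField.Normc.

Local Open Scope classical_set_scope.
Local Open Scope ring_scope.
Local Open Scope complex_scope.

Local Arguments normc : simpl never.

(** * The norm of the sequence space and finitely supported vectors *)

Section LpBasics.
Context {R : realType} {A : countType} {p : R} {hp : 1 < p}.
Local Notation X := (lp A hp).
Implicit Types (f g : X) (v : A) (c e : R).

(** The norm of a complex normed module is a complex number; this is the same
    number read in [R], where the order is total. *)
Definition nrm (f : X) : R := lp_norm p f.

Let p0 : 0 < p. Proof. exact: lt_trans hp. Qed.

Lemma lpD f g v : (f + g) v = f v + g v. Proof. by []. Qed.
Lemma lpB f g v : (f - g) v = f v - g v. Proof. by []. Qed.
Lemma lpZ (c : R[i]) f v : (c *: f) v = c * f v. Proof. by []. Qed.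
Lemma lp0 v : (0 : X) v = 0. Proof. by []. Qed.
Lemma lp_sumrE (I : Type) (r : seq I) (P : pred I) (F : I -> X) v :
  (\sum_(i <- r | P i) F i) v = \sum_(i <- r | P i) F i v.
Proof. by elim/big_rec2: _ => // i y x _ <-. Qed.

Lemma lp_ext f g : (forall v, f v = g v) -> f = g.
Proof. by move=> fg; apply/val_inj/funext. Qed.

Lemma nrm_ge0 f : 0 <= nrm f. Proof. exact: lp_norm_ge0. Qed.
Lemma nrmD f g : nrm (f + g) <= nrm f + nrm g.
Proof. exact: (lp_normD hp (lp_fin f) (lp_fin g)). Qed.
Lemma nrmZ (c : R[i]) f : nrm (c *: f) = normc c * nrm f.
Proof. exact: (lp_normZ hp c (lp_fin f)). Qed.
Lemma nrm0 : nrm 0 = 0.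
Proof. by rewrite -(scale0r (0 : X)) nrmZ normc0 mul0r. Qed.
Lemma nrmN f : nrm (- f) = nrm f.
Proof. by rewrite -scaleN1r nrmZ normcN normc1 mul1r. Qed.
Lemma nrmB f g : nrm (f - g) = nrm (g - f).
Proof. by rewrite -nrmN opprB. Qed.
Lemma nrm_sum (I : Type) (r : seq I) (P : pred I) (F : I -> X) :
  nrm (\sum_(i <- r | P i) F i) <= \sum_(i <- r | P i) nrm (F i).
Proof.
elim/big_rec2: _ => [|i x y _ xy]; first by rewrite nrm0.
by apply: le_trans (nrmD _ _) _; rewrite lerD2l.
Qed.
Lemma nrm_eq0 f : nrm f = 0 -> f = 0.
Proof. by move=> f0; apply: lp_ext => v; exact: (lp_norm_eq0 hp (lp_fin f) f0). Qed.

Lemma lp_sum_nrm f : lp_sum p f = (nrm f `^ p)%:E.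
Proof. by rewrite lp_norm_powR ?lp_fin. Qed.

Lemma nrm_le f c : 0 <= c -> (lp_sum p f <= (c `^ p)%:E)%E -> nrm f <= c.
Proof.
move=> c0; rewrite lp_sum_nrm lee_fin => h.
rewrite leNgt; apply/negP => cf; move: h; apply/negP; rewrite -ltNge.
by rewrite gt0_ltr_powR ?nnegrE ?nrm_ge0.
Qed.

Lemma nrm_lt f c : 0 <= c -> (lp_sum p f < (c `^ p)%:E)%E -> nrm f < c.
Proof.
move=> c0; rewrite lp_sum_nrm lte_fin => h.
rewrite ltNge; apply/negP => cf; move: h; apply/negP; rewrite -leNgt.
by rewrite ge0_ler_powR ?nnegrE ?nrm_ge0 ?(ltW p0).
Qed.

Lemma normc_le_nrm f v : normc (f v) <= nrm f.
Proof.
have h : ((normc (f v) `^ p)%:E <= lp_sum p f)%E.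
  apply: (@le_esum_term _ _ _ (fun v => normc (f v) `^ p)) => // ?.
  by rewrite powR_ge0.
move: h; rewrite lp_sum_nrm lee_fin => h.
rewrite leNgt; apply/negP => cf; move: h; apply/negP; rewrite -ltNge.
by rewrite gt0_ltr_powR ?nnegrE ?normc_ge0 ?nrm_ge0.
Qed.

Lemma nrm_dominated f g c : 0 <= c ->
  (forall v, normc (f v) <= c * normc (g v)) -> nrm f <= c * nrm g.
Proof.
move=> c0 fg; apply: nrm_le; first by rewrite mulr_ge0 ?nrm_ge0.
rewrite powRM ?nrm_ge0// EFinM -lp_sum_nrm -esumZl ?powR_ge0//; last first.
  by move=> ?; rewrite powR_ge0.
apply: le_esum => v _; rewrite lee_fin -powRM ?normc_ge0//.
by rewrite ge0_ler_powR ?nnegrE ?(ltW p0) ?mulr_ge0 ?normc_ge0.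
Qed.

Fact delta_subproof v : (fun u => (u == v)%:R : R[i]) \in lp_pred hp.
Proof.
rewrite inE /lp_sum (_ : esum _ _ = 1%:E) ?ltry//.
rewrite (esumID [set v])//; last by move=> i _; rewrite lee_fin powR_ge0.
rewrite setTI setTI esum_set1 ?lee_fin ?powR_ge0//.
rewrite eqxx normc1 powR1 esum1 ?adde0// => i /= /eqP/negPf ->.
by rewrite normc0 powR0 ?gt_eqF.
Qed.
Definition delta v : X := Lp (delta_subproof v).

Lemma deltaE v u : delta v u = (u == v)%:R. Proof. by []. Qed.

Fact restr_subproof (P : pred A) f :
  (fun u => if P u then f u else 0) \in lp_pred hp.
Proof.
rewrite inE; apply: le_lt_trans (lp_fin f).
apply: le_esum => v _; case: ifP => _ //.
by rewrite normc0 powR0 ?gt_eqF// lee_fin powR_ge0.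
Qed.
Definition restr (P : pred A) f : X := Lp (restr_subproof P f).

Lemma restrE (P : pred A) f u : restr P f u = if P u then f u else 0.
Proof. by []. Qed.

Lemma sum_deltaE (s : seq A) (c : A -> R[i]) u : uniq s ->
  (\sum_(v <- s) c v *: delta v) u = if u \in s then c u else 0.
Proof.
move=> us; rewrite lp_sumrE; case: ifPn => [us'|uNs].
  rewrite (bigD1_seq u)// lpZ deltaE eqxx mulr1 big1 => [|i iu].
    by rewrite /= addr0.
  by rewrite lpZ deltaE eq_sym (negPf iu) mulr0.
rewrite big_seq big1// => i iS; rewrite lpZ deltaE.
by case: eqVneq => [ui|]; rewrite ?mulr0//; move: uNs; rewrite ui iS.
Qed.

Lemma lp_sum_restr (P : pred A) f :
  lp_sum p f = (lp_sum p (restr P f) + lp_sum p (restr (predC P) f))%E.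
Proof.
rewrite /lp_sum -esumD; try by move=> v _; rewrite lee_fin powR_ge0.
apply: eq_esum => v _; rewrite -EFinD !restrE /=.
by case: (P v); rewrite /= normc0 powR0 ?gt_eqF ?addr0 ?add0r.
Qed.

Lemma lp_sum_finite (s : seq A) f : uniq s -> (forall u, u \notin s -> f u = 0) ->
  lp_sum p f = (\sum_(v <- s) normc (f v) `^ p)%:E.
Proof.
move=> us f0; rewrite /lp_sum (esumID [set` s])//; last first.
  by move=> i _; rewrite lee_fin powR_ge0.
rewrite !setTI [X in (_ + X)%E]esum1 ?adde0; last first.
  by move=> i /= /negP /f0 ->; rewrite normc0 powR0 ?gt_eqF.
rewrite esum_fset; [|exact: finite_seq|by move=> i _; rewrite lee_fin powR_ge0].
by rewrite -fsbig_seq// sumEFin.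
Qed.

Lemma nrm_finite (s : seq A) f : uniq s -> (forall u, u \notin s -> f u = 0) ->
  nrm f = (\sum_(v <- s) normc (f v) `^ p) `^ p^-1.
Proof. by move=> us f0; rewrite /nrm /lp_norm (lp_sum_finite us f0). Qed.

Lemma nrm_delta v : nrm (delta v) = 1.
Proof.
rewrite (@nrm_finite [:: v])// => [|u]; last by rewrite inE deltaE => /negPf ->.
by rewrite big_seq1 deltaE eqxx normc1 !powR1.
Qed.

Lemma finite_approx f e : 0 < e ->
  exists2 s, uniq s & nrm (f - \sum_(v <- s) f v *: delta v) < e.
Proof.
move=> e0; have fin := lp_sum_nrm f.
have e'0 : 0 < e `^ p by rewrite powR_gt0.
have num : lp_sum p f \is a fin_num by rewrite fin.
have : (lp_sum p f - (e `^ p)%:E < lp_sum p f)%E.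
  by rewrite lteBlDr// lteDl// lte_fin.
rewrite {2}/lp_sum => /ereal_sup_gt [_ [F [finF _] <-]] lt.
set s := enum_fset (fset_set F).
exists s; first exact: fset_uniq.
have us : uniq s by exact: fset_uniq.
have -> : f - \sum_(v <- s) f v *: delta v = restr (predC (mem s)) f.
  apply: lp_ext => v; rewrite lpB sum_deltaE// restrE /=.
  by case: (v \in s); rewrite /= ?subrr ?subr0.
apply: nrm_lt (ltW e0) _; move: lt; rewrite (lp_sum_restr (mem s)).
rewrite (@lp_sum_finite s (restr (mem s) f))//; last first.
  by move=> u /negPf us'; rewrite restrE /= us'.
set x := \sum_(v <- s) _.
have -> : (\sum_(x \in F) (normc (f x) `^ p)%:E = x%:E)%E.
  rewrite fsbig_finite//= sumEFin; congr EFin; rewrite /x !big_seq.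
  by apply: eq_bigr => v vs; rewrite restrE /= vs.
by rewrite lp_sum_nrm -!EFinD !lte_fin; lra.
Qed.

Lemma nrm_normr f : `|f| = (nrm f)%:C. Proof. exact: lp_normE. Qed.

Lemma open_nrm (U : set X) f : open U -> U f ->
  exists2 e : R, 0 < e & forall g, nrm (g - f) < e -> U g.
Proof.
move=> oU Uf; have /nbhs_ballP[e /= e0 eU] : nbhs f U by exact: open_nbhs_nbhs.
have eE : e = (complex.Re e)%:C by rewrite RRe_real// gtr0_real.
exists (complex.Re e); first by rewrite -ltcR -eE.
move=> g; rewrite -ltcR -eE => gf; apply: eU.
by rewrite -ball_normE /= -opprB normrN nrm_normr.
Qed.

Lemma open_nrm_ball f e : open [set g | nrm (g - f) < e].
Proof.
have -> : [set g | nrm (g - f) < e] = ball f e%:C.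
  apply/funext => g; rewrite -ball_normE /= -opprB normrN nrm_normr ltcR //.
exact: ball_open.
Qed.

End LpBasics.

(** * Generations and recursion in a rooted tree *)

Section Generations.
Context {A : countType} (E : rel A).

Lemma Chin_cat m n u v w : Chin E m u v -> Chin E n v w -> Chin E (m + n) u w.
Proof.
move=> uv; elim: n w => [|n IH] w /=; first by move->; rewrite addn0.
by move=> [x vx xw]; rewrite addnS; exists x => //; exact: IH.
Qed.

Lemma Chin1 u v : E u v -> Chin E 1 u v.
Proof. by move=> uv; exists u. Qed.

Lemma Chin_nonempty : leafless E -> forall n v, exists w, Chin E n v w.
Proof.
move=> lE; elim=> [|n IH] v; first by exists v.
by have [w vw] := IH v; have [x wx] := lE w; exists x, w.
Qed.

Definition descendant v w := exists n, Chin E n v w.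

Lemma descendant_refl v : descendant v v. Proof. by exists 0%N. Qed.
Lemma descendant_trans v u w : descendant u v -> descendant v w -> descendant u w.
Proof. by move=> [m uv] [n vw]; exists (m + n)%N; exact: Chin_cat uv vw. Qed.
Lemma descendant1 u v : E u v -> descendant u v.
Proof. by move=> uv; exists 1%N; exact: Chin1. Qed.

Hypothesis upar : forall a a' b, E a b -> E a' b -> a = a'.

Lemma Chin_inj n u v w : Chin E n u w -> Chin E n v w -> u = v.
Proof.
elim: n w => [|n IH] w /=; first by move=> -> ->.
by move=> [x ux xw] [y vy yw]; rewrite (upar yw xw) in vy; exact: IH ux vy.
Qed.

Definition branches u := exists a b, [/\ E u a, E u b & a != b].

(** Induction on [K]: below a branching vertex, the induction hypothesis gives
    [K] vertices of a late generation under one child, and leaflessness gives at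
    least one more under the other child; uniqueness of parents keeps the two
    families disjoint. *)
Lemma branching_growth : leafless E -> forall K v,
  (forall w, descendant v w -> exists2 u, descendant w u & branches u) ->
  exists N, forall n, (N <= n)%N ->
    exists s, [/\ uniq s, size s = K & forall x, x \in s -> Chin E n v x].
Proof.
move=> lE; elim=> [|K IH] v brv.
  by exists 0%N => n _; exists [::].
have [u [j vu] [a [b [ua ub ab]]]] := brv v (descendant_refl v).
have va : descendant v a.
  by apply: descendant_trans (descendant1 ua); exists j.
have [N HN] := IH a (fun w aw => brv w (descendant_trans va aw)).
exists (j + (1 + N))%N => n Nn.
have [m nE Nm] : exists2 m, n = (j + (1 + m))%N & (N <= m)%N.
  by exists (n - j.+1)%N; lia.
have [s [us ss Hs]] := HN m Nm.
have [t bt] := Chin_nonempty lE m b.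
have Chiv c x : E u c -> Chin E m c x -> Chin E n v x.
  by move=> uc cx; rewrite nE; exact: Chin_cat vu (Chin_cat (Chin1 uc) cx).
exists (t :: s); split=> [||x].
- rewrite /= us andbT; apply/negP => /Hs at_.
  by move: ab; rewrite (Chin_inj at_ bt) eqxx.
- by rewrite /= ss.
- rewrite inE => /orP[/eqP ->|/Hs ax]; [exact: Chiv ub bt|exact: Chiv ua ax].
Qed.

End Generations.

Lemma card_ge_seq (A : choiceType) (s : seq A) (S : set A) : uniq s ->
  (forall x, x \in s -> S x) -> (`I_(size s) #<= S)%card.
Proof.
case: s => [|x0 s] us sS; first by rewrite II0 card_ge0.
have inj : {in `I_(size (x0 :: s)) &, injective (nth x0 (x0 :: s))}.
  by move=> i j /set_mem /= ? /set_mem /= ? /eqP; rewrite nth_uniq// => /eqP.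
have /card_eqPle[_ h] := inj_card_eq inj.
apply: card_le_trans h _; apply: subset_card_le => _ [i /= ? <-].
by apply: sS; rewrite mem_nth.
Qed.

Lemma card_ge2 (A : Type) (S : set A) (a : A) :
  (`I_2 #<= S)%card -> S `<=` [set a] -> False.
Proof.
move=> S2 /subset_card_le Sa.
have := card_le_trans S2 Sa.
by rewrite (card_le_eqr card_set1) card_le_II.
Qed.

Section RootedTree.
Context {A : countType} (E : rel A) (treeE : directed_tree E).
Context (r : A) (rr : is_root E r).

Lemma tree_upar a a' b : E a b -> E a' b -> a = a'.
Proof. by case: treeE => _ _ _; exact. Qed.

(** An undirected path from the root can only go down: a step up from a vertex
    already known to lie below the root leads to its only parent, which lies
    below the root too. *)
Lemma root_descendant v : descendant E r v.
Proof.
case: treeE => cE _ _ upar; have [s [ps <-]] := cE r v.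
suff: forall a, descendant E r a -> path (fun x y => E x y || E y x) a s ->
    descendant E r (last a s).
  by apply=> //; exact: descendant_refl.
elim: s {ps} => [|b s IH] a ra //= /andP[ab bs]; apply: IH => //.
case/orP: ab => ab; first by apply: descendant_trans ra (descendant1 ab).
case: ra => -[/= ar|n]; first by move: ab; rewrite ar (negPf (rr b)).
by move=> [x rx xa]; exists n; rewrite (upar _ _ _ ab xa).
Qed.

Lemma Chin_root_inj n m v : Chin E n r v -> Chin E m r v -> n = m.
Proof.
elim: n m v => [|n IH] [|m] v //=.
- by move=> -> [x _ xr]; move: (rr x); rewrite xr.
- by move=> [x _ xr] vr; move: (rr x); rewrite -vr xr.
- move=> [x rx xv] [y ry yv]; rewrite (tree_upar yv xv) in ry.
  by rewrite (IH _ _ rx ry).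
Qed.

Definition dep v : nat := xget 0%N [set n | Chin E n r v].

Lemma dep_Chin_root v : Chin E (dep v) r v.
Proof. by rewrite /dep; case: xgetP => // h; case: (root_descendant v) => n /h. Qed.

Lemma dep_Chin n u v : Chin E n u v -> dep v = (dep u + n)%N.
Proof.
move=> uv; apply: (Chin_root_inj (dep_Chin_root v)).
exact: Chin_cat (dep_Chin_root u) uv.
Qed.

Lemma dep_child u v : E u v -> dep v = (dep u).+1.
Proof. by move/Chin1/dep_Chin => ->; rewrite addn1. Qed.

Lemma dep_root : dep r = 0%N.
Proof. exact: (Chin_root_inj (dep_Chin_root r)). Qed.

Lemma root_or_child v : v = r \/ exists u, E u v.
Proof.
have := dep_Chin_root v; case: (dep v) => [/= ->|n [u _ uv]]; first by left.
by right; exists u.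
Qed.

(** At the root, which has no parent, the value is the root itself. *)
Definition par v : A := xget v [set u | E u v].

Lemma parE u v : E u v -> par v = u.
Proof.
move=> uv; rewrite /par; case: xgetP => [w _ wv|/(_ u)//].
exact: tree_upar wv uv.
Qed.

(** Since every vertex lies below the root at a well-defined depth, a function on
    the vertices may be defined from its value at the parent. Cumulative
    weights and masses arise in this way. *)
Lemma tree_rec (T : Type) (x0 : T) (F : A -> T -> T) :
  exists f : A -> T, f r = x0 /\ forall u v, E u v -> f v = F v (f u).
Proof.
pose g := fix g n v := if n is m.+1 then F v (g m (par v)) else x0.
exists (fun v => g (dep v) v); split; first by rewrite dep_root.
by move=> u v uv; rewrite (dep_child uv) /= (parE uv).
Qed.

Lemma tree_ind (P : A -> Prop) :
  P r -> (forall u v, E u v -> P u -> P v) -> forall v, P v.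
Proof.
move=> Pr IH v; have := dep_Chin_root v; move: (dep v) => n; elim: n v => [|n IHn] v /=.
  by move->.
by move=> [u /IHn Pu uv]; exact: IH uv Pu.
Qed.

End RootedTree.

(** * Iterates of a weighted backward shift *)

Section ShiftBasics.
Context {R : realType} {A : countType} {p : R} {hp : 1 < p}.
Local Notation X := (lp A hp).
Context (E : rel A) (treeE : directed_tree E) (r : A) (rr : is_root E r).
Context (lam : A -> R[i]) (T : X -> X).
Hypotheses (BT : is_backward_shift E lam T) (bT : bounded_operator T).
Implicit Types (f g : X).

Lemma shift_lim f v (l : R[i]^o) :
  summability.partial_sum
        (patch (fun=> 0) (Chi E v) (fun u => lam u * f u : R[i]^o)) @
      summability.totally --> l -> T f v = l.
Proof.
have pf : ProperFilter (@summability.totally A) by exact: summability.totally_filter.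
by move=> h; exact: (@norm_cvg_unique _ R[i]^o _ _ _ _ (@BT f v) h).
Qed.

Lemma shift_zero f v : (forall u, E v u -> f u = 0) -> T f v = 0.
Proof.
move=> f0; apply: shift_lim.
have pf : ProperFilter (@summability.totally A) by exact: summability.totally_filter.
apply: cvg_near_cst; apply: nearW => F.
rewrite /summability.partial_sum big1// => i _; rewrite patchE.
by case: ifPn => // /set_mem /= /f0 ->; rewrite mulr0.
Qed.

Lemma shift_single f v u : E v u -> (forall w, E v w -> w != u -> f w = 0) ->
  T f v = lam u * f u.
Proof.
move=> vu f0; apply: shift_lim.
have pf : ProperFilter (@summability.totally A) by exact: summability.totally_filter.
apply: cvg_near_cst.
exists [fset u]%fset => // F /= /fsubsetP uF.
have {}uF : u \in F by apply: uF; rewrite inE.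
rewrite /summability.partial_sum (bigD1 [` uF]%fset)//= big1 => [|i iu].
  by rewrite addr0 patchE ifT //; exact: mem_set.
rewrite patchE; case: ifPn => // /set_mem /= vi.
by rewrite f0 ?mulr0//; apply: contra iu => /eqP iu; apply/eqP/val_inj.
Qed.

Lemma shift_linear (a : R[i]) f g : T (a *: f + g) = a *: T f + T g.
Proof. case: bT => lT _; exact (lT a f g). Qed.

Lemma iter_linear n (a : R[i]) f g :
  iter n T (a *: f + g) = a *: iter n T f + iter n T g.
Proof. by elim: n => [//|n IH]; rewrite !iterS IH shift_linear. Qed.

Lemma iterD n f g : iter n T (f + g) = iter n T f + iter n T g.
Proof. by rewrite -[f]scale1r iter_linear !scale1r. Qed.

Lemma iter0 n : iter n T 0 = 0.
Proof.
by have := iterD n 0 0; rewrite addr0 -{1}[iter n T 0]addr0 => /addrI <-.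
Qed.

Lemma iterZ n (a : R[i]) f : iter n T (a *: f) = a *: iter n T f.
Proof. by rewrite -[a *: f]addr0 iter_linear iter0 addr0. Qed.

Lemma iter_sum n (I : Type) (s : seq I) (F : I -> X) :
  iter n T (\sum_(i <- s) F i) = \sum_(i <- s) iter n T (F i).
Proof.
elim: s => [|i s IH]; first by rewrite !big_nil iter0.
by rewrite !big_cons iterD IH.
Qed.

Lemma iter_bound : exists2 M : R, 1 <= M &
  forall n f, nrm (iter n T f) <= M ^+ n * nrm f.
Proof.
case: bT => _ [M HM].
have HM' f : nrm (T f) <= Num.max 1 M * nrm f.
  have := HM f; rewrite !nrm_normr -rmorphM/= lecR => h.
  by apply: le_trans h _; rewrite ler_wpM2r ?nrm_ge0// le_max lexx orbT.
have M1 : 1 <= Num.max 1 M by rewrite le_max lexx.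
exists (Num.max 1 M) => //; elim=> [|n IH] f; first by rewrite expr0 mul1r.
rewrite iterS exprS -mulrA; apply: le_trans (HM' _) _.
by rewrite ler_wpM2l// (le_trans _ M1).
Qed.

(** The shift moves values one step towards the root and drops the value at the
    root, so [n] steps push the first [n] generations out of the tree. *)
Lemma iter_low n f : (forall v, (n <= dep E r v)%N -> f v = 0) -> iter n T f = 0.
Proof.
elim: n f => [|n IH] f f0; first by apply: lp_ext => v; exact: f0.
rewrite iterSr; apply: IH => v nv; apply: shift_zero => u vu.
by apply: f0; rewrite (dep_child treeE rr vu).
Qed.

Lemma shift_delta u v : E v u -> T (delta u) = lam u *: delta v.
Proof.
move=> vu; apply: lp_ext => w; rewrite lpZ deltaE.
case: eqVneq => [->|wv].
  rewrite (shift_single vu) ?deltaE ?eqxx// => x _ /negPf xu.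
  by rewrite deltaE xu.
rewrite mulr0; apply: shift_zero => x wx; rewrite deltaE.
case: eqVneq wx => // -> wu; move: wv.
by rewrite (tree_upar treeE wu vu) eqxx.
Qed.

(* [Lam v] is the product of the weights along the path from the root to [v],
   so [Lam u / Lam v] is the product along the path from [v] to [u]. *)
Context (Lam : A -> R[i]).
Hypotheses (Lam0 : forall v, Lam v != 0)
  (LamE : forall u v, E u v -> Lam v = lam v * Lam u).

Lemma iter_delta n u v : Chin E n v u ->
  iter n T (delta u) = (Lam u / Lam v) *: delta v.
Proof.
elim: n u => [|n IH] u; first by move=> /= ->; rewrite divff// scale1r.
move=> [w vw wu]; rewrite iterSr (shift_delta wu) iterZ (IH _ vw) scalerA.
by rewrite (LamE wu) mulrA.
Qed.

Lemma iter_ray (w : nat -> A) k f :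
  (forall n, E (w n) (w n.+1)) -> (forall n x, E (w n) x -> x = w n.+1) ->
  iter k T f (w 0%N) = Lam (w k) / Lam (w 0%N) * f (w k).
Proof.
elim: k w => [|k IH] w Ew uw; first by rewrite divff// mul1r.
rewrite iterS (@shift_single _ _ _ (Ew 0%N)); last first.
  by move=> x /uw -> /eqP.
rewrite (IH (fun n => w n.+1) (fun n => Ew n.+1) (fun n => @uw n.+1)) /= (LamE (Ew 0%N)).
have lam0 : lam (w 1%N) != 0.
  by apply: contra_neq (Lam0 (w 1%N)) => l0; rewrite (LamE (Ew 0%N)) l0 mul0r.
have Lam0' := Lam0 (w 0%N).
by field; apply/andP.
Qed.

End ShiftBasics.

(** * Unconditional sums of complex families *)

Lemma ler_sum_sub (R : realType) (I : eqType) (s t : seq I) (f : I -> R) :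
  uniq s -> uniq t -> {subset s <= t} -> (forall i, 0 <= f i) ->
  \sum_(i <- s) f i <= \sum_(i <- t) f i.
Proof.
move=> us ut st f0; rewrite [leRHS](bigID (mem s))/=.
rewrite [X in _ <= X + _](_ : _ = \sum_(i <- s) f i).
  by rewrite lerDl sumr_ge0.
rewrite -big_filter; apply: perm_big; apply: uniq_perm => //.
  by rewrite filter_uniq.
by move=> x; rewrite mem_filter; case: (boolP (x \in s)) => // /st ->.
Qed.

Section UnconditionalSums.
Context {R : realType} {A : countType}.
Implicit Types (a b : A -> R[i]) (l : R[i]) (F : {fset A}) (e B : R).

(** Convergence of the finite partial sums along the inclusion order, with real
    tolerances; [usum_limP] identifies it with the filter formulation. *)
Definition usum_lim a l := forall e, 0 < e -> exists F0, forall F,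
  (F0 `<=` F)%fset -> normc (l - \sum_(i <- F) a i) < e.

Lemma usum_limP a l :
  (summability.partial_sum (a : A -> R[i]^o) @ summability.totally --> (l : R[i]^o))
  <-> usum_lim a l.
Proof.
have pf : ProperFilter (@summability.totally A) by exact: summability.totally_filter.
have psE F : summability.partial_sum (a : A -> R[i]^o) F = \sum_(i <- F) a i.
  by rewrite /summability.partial_sum big_seq_fsetE.
split=> [/cvgrPdist_lt h e e0|h].
  have e0' : 0 < e%:C by rewrite ltcR.
  have [F0 _ HF0] := h _ e0'; exists F0 => F F0F.
  by have := HF0 F F0F; rewrite psE -ltcR.
apply/cvgrPdist_lt => e e0.
have eE : e = (complex.Re e)%:C by rewrite RRe_real// gtr0_real.
rewrite eE; have [|F0 HF0] := h (complex.Re e); first by rewrite -ltcR -eE.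
by exists F0 => // F /HF0; rewrite -ltcR psE.
Qed.

Lemma usum_lim_unique a l l' : usum_lim a l -> usum_lim a l' -> l = l'.
Proof.
have pf : ProperFilter (@summability.totally A) by exact: summability.totally_filter.
by move=> /usum_limP h /usum_limP h'; exact: (@norm_cvg_unique _ R[i]^o _ _ _ _ h h').
Qed.

Lemma usum_lim_ext a b l : a =1 b -> usum_lim a l -> usum_lim b l.
Proof. by move=> /funext ->. Qed.

Lemma usum_limD a b l l' : usum_lim a l -> usum_lim b l' ->
  usum_lim (fun u => a u + b u) (l + l').
Proof.
move=> ha hb e e0; have e20 : 0 < e / 2 by rewrite divr_gt0.
have [F1 H1] := ha _ e20; have [F2 H2] := hb _ e20.
exists (F1 `|` F2)%fset => F; rewrite fsubUset => /andP[/H1 h1 /H2 h2].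
rewrite big_split /= opprD addrACA (splitr e).
by apply: le_lt_trans (le_normcD _ _) _; rewrite ltrD.
Qed.

Lemma usum_limZ c a l : usum_lim a l -> usum_lim (fun u => c * a u) (c * l).
Proof.
move=> ha e e0.
have d0 : 0 < normc c + 1 by rewrite ltr_wpDl ?normc_ge0.
have [|F0 H] := ha (e / (normc c + 1)); first by rewrite divr_gt0.
exists F0 => F /H h; rewrite -mulr_sumr -mulrBr normcM.
move: h; rewrite ltr_pdivlMr// => h; apply: le_lt_trans h.
by rewrite mulrC ler_wpM2l ?normc_ge0// lerDl.
Qed.

Lemma usum_lim_bound a l B :
  (forall F, normc (\sum_(i <- F) a i) <= B) -> usum_lim a l -> normc l <= B.
Proof.
move=> HB ha; apply/ler_addgt0Pr => e e0.
have [F0 /(_ F0 (fsubset_refl _)) h] := ha _ e0.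
rewrite -[l](subrK (\sum_(i <- F0) a i)) addrC.
by apply: le_trans (le_normcD _ _) _; rewrite lerD// ltW.
Qed.

Lemma normc_sum (I : Type) (s : seq I) (P : pred I) (f : I -> R[i]) :
  normc (\sum_(i <- s | P i) f i) <= \sum_(i <- s | P i) normc (f i).
Proof.
elim/big_rec2: _ => [|i x y _ xy]; first by rewrite normc0.
by apply: le_trans (le_normcD _ _) _; rewrite lerD2l.
Qed.

Lemma normcX (z : R[i]) n : normc (z ^+ n) = normc z ^+ n.
Proof. by elim: n => [|n IH]; rewrite ?expr0 ?normc1// !exprS normcM IH. Qed.

Lemma normc_real (x : R) : normc x%:C = `|x|.
Proof. by rewrite /normc /= expr0n addr0 sqrtr_sqr. Qed.

Lemma normc_Re (z : R[i]) : `|complex.Re z| <= normc z.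
Proof. by rewrite -lecR; exact: normc_ge_Re. Qed.

Lemma normc_Im (z : R[i]) : `|complex.Im z| <= normc z.
Proof. by case: z => x y; rewrite /normc /= -sqrtr_sqr ler_wsqrtr// lerDr sqr_ge0. Qed.

(** The sum is the supremum of the finite partial sums. *)
Lemma usum_lim_nonneg (b : A -> R) B : (forall u, 0 <= b u) ->
  (forall F, \sum_(i <- F) b i <= B) ->
  exists l : R, usum_lim (fun u => (b u)%:C) l%:C.
Proof.
move=> b0 bB; set S := [set \sum_(i <- F) b i | F in [set: {fset A}]].
have hS : has_sup S.
  split; first by exists (\sum_(i <- fset0) b i), fset0.
  by exists B => _ [F _ <-].
exists (sup S) => e e0; have [_ [F0 _ <-] h] := sup_adherent e0 hS.
exists F0 => F /fsubsetP F0F; rewrite -rmorph_sum -rmorphB /= normc_real.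
have le1 : \sum_(i <- F) b i <= sup S by apply: sup_upper_bound => //; exists F.
have le2 : \sum_(i <- F0) b i <= \sum_(i <- F) b i.
  by apply: ler_sum_sub => //; exact: fset_uniq.
by rewrite ger0_norm ?subr_ge0//; lra.
Qed.

(** A complex family is a combination of the positive and negative parts of its
    real and imaginary parts, and each of these sums is a supremum. *)
Lemma usum_lim_exists a B :
  (forall F, \sum_(i <- F) normc (a i) <= B) -> exists l, usum_lim a l.
Proof.
move=> aB.
have pos (b : A -> R) : (forall u, 0 <= b u) -> (forall u, b u <= normc (a u)) ->
    exists l : R, usum_lim (fun u => (b u)%:C) l%:C.
  move=> b0 ba; apply: usum_lim_nonneg (B) b0 _ => F.
  by apply: le_trans (aB F); apply: ler_sum.
have real (b : A -> R) : (forall u, `|b u| <= normc (a u)) ->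
    exists l, usum_lim (fun u => (b u)%:C) l.
  move=> ba; have [u||l1 h1] := pos (fun u => Num.max (b u) 0).
  - by rewrite le_max lexx orbT.
  - by move=> u; rewrite ge_max normc_ge0 andbT (le_trans (ler_norm _)).
  have [u||l2 h2] := pos (fun u => Num.max (- b u) 0).
  - by rewrite le_max lexx orbT.
  - by move=> u; rewrite ge_max normc_ge0 andbT (le_trans (ler_norm _))// normrN.
  exists (l1%:C + (-1) * l2%:C).
  apply: usum_lim_ext (usum_limD h1 (usum_limZ (-1) h2)) => u /=.
  rewrite mulN1r -rmorphB /=; congr (_ %:C).
  by have [b0|b0] := leP (b u) 0; have [b1|b1] := leP (- b u) 0; lra.
have [|l1 h1] := real (fun u => complex.Re (a u)); first by move=> u; exact: normc_Re.
have [|l2 h2] := real (fun u => complex.Im (a u)); first by move=> u; exact: normc_Im.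
exists (l1 + 'i%C * l2).
apply: usum_lim_ext (usum_limD h1 (usum_limZ 'i%C h2)) => u /=.
by rewrite -complexE.
Qed.

End UnconditionalSums.

Section EsumFibres.
Context {R : realType}.
Local Open Scope ereal_scope.

Lemma esum_subset (T : choiceType) (S D : set T) (a : T -> \bar R) :
  (forall x, 0 <= a x) -> S `<=` D -> \esum_(t in S) a t <= \esum_(t in D) a t.
Proof.
move=> a0 SD; apply: le_ereal_sup => _ [F [finF FS] <-].
by exists F => //; split=> //; exact: subset_trans FS SD.
Qed.

Lemma esum_fibres_le (I T : choiceType) (S : set I) (J : I -> set T)
    (D : set T) (a : T -> \bar R) : (forall x, 0 <= a x) ->
  (forall i j t, J i t -> J j t -> i = j) -> (forall i, S i -> J i `<=` D) ->
  \esum_(i in S) \esum_(t in J i) a t <= \esum_(t in D) a t.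
Proof.
move=> a0 inj SD; rewrite esum_esum//.
apply: le_trans (@esum_subset _ (\bigcup_(i in S) J i) D a a0 _); last first.
  by move=> t [i Si Jt]; exact: SD Si t Jt.
rewrite le_eqVlt; apply/orP; left; apply/eqP; symmetry.
apply: (@reindex_esum _ _ _ _ _ snd a) => //; split.
- by move=> [i t] /= [Si Jt]; exists i.
- move=> [i t] [j t'] /set_mem [/= _ Jt] /set_mem [/= _ Jt'] /= tt'.
  by rewrite -tt' in Jt' *; rewrite (inj _ _ _ Jt Jt').
- by move=> t [i Si Jt]; exists (i, t).
Qed.

End EsumFibres.

(** * Bounded shifts from weights summable over children *)

Section ShiftExistence.
Context {R : realType} {A : countType} {p : R} {hp : 1 < p}.
Local Notation X := (lp A hp).
Context (E : rel A) (upar : forall a a' b, E a b -> E a' b -> a = a').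
Context (w : A -> R) (B : R) (w0 : forall u, 0 <= w u) (B0 : 0 <= B).
Hypothesis wB : forall v (F : {fset A}), \sum_(u <- F | E v u) w u <= B.

Let p0 : 0 < p. Proof. exact: lt_trans hp. Qed.

Let term (f : X) v := patch (fun=> 0) (Chi E v) (fun u => (w u)%:C * f u).

Let termE f v u : term f v u = if E v u then (w u)%:C * f u else 0.
Proof.
rewrite /term /patch; case: ifPn => [/set_mem /= ->//|].
by case: ifPn => // vu /negP[]; exact: mem_set.
Qed.

Let term_bound f v (F : {fset A}) : \sum_(u <- F) normc (term f v u) <= B * nrm (restr (E v) f).
Proof.
apply: le_trans (_ : \sum_(u <- F | E v u) w u * nrm (restr (E v) f) <= _).
  rewrite [leRHS]big_mkcond /=; apply: ler_sum => u _; rewrite termE.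
  case: ifPn => vu; last by rewrite normc0.
  rewrite normcM normc_real ger0_norm// ler_wpM2l//.
  by have := normc_le_nrm (restr (E v) f) u; rewrite restrE vu.
by rewrite -mulr_suml; apply: ler_wpM2r; [exact: nrm_ge0|exact: wB].
Qed.

Let shift_val (f : X) v : R[i] := projT1 (cid (usum_lim_exists (@term_bound f v))).

Let shift_valP f v : usum_lim (term f v) (shift_val f v).
Proof. by rewrite /shift_val; case: cid. Qed.

Let shift_val_le f v : normc (shift_val f v) <= B * nrm (restr (E v) f).
Proof.
apply: (usum_lim_bound _ (shift_valP f v)) => F.
exact: le_trans (normc_sum _ _ _) (term_bound f v F).
Qed.

Let shift_val_lp_sum f : (lp_sum p (shift_val f) <= (B `^ p)%:E * lp_sum p f)%E.
Proof.
apply: le_trans (_ : _ <= (B `^ p)%:E * \esum_(v in [set: A]) \esum_(u in Chi E v)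
   (normc (f u) `^ p)%:E)%E _.
  have esumE v : (\esum_(u in Chi E v) (normc (f u) `^ p)%:E =
      (nrm (restr (E v) f) `^ p)%:E)%E.
    rewrite -lp_sum_nrm /lp_sum esum_mkcond; apply: eq_esum => u _.
    rewrite restrE; case: ifPn => [/set_mem /= ->//|].
    case: ifPn => [vu /negP[]|_ _]; first exact: mem_set.
    by rewrite normc0 powR0 ?gt_eqF.
  rewrite (eq_esum (fun v _ => esumE v)) -esumZl ?powR_ge0//; last first.
    by move=> ?; rewrite powR_ge0.
  apply: le_esum => v _; rewrite lee_fin -powRM ?nrm_ge0//.
  by rewrite ge0_ler_powR ?nnegrE ?(ltW p0) ?normc_ge0 ?mulr_ge0 ?nrm_ge0.
rewrite lee_wpmul2l ?lee_fin ?powR_ge0//.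
apply: esum_fibres_le => [u|i j t|//]; first by rewrite lee_fin powR_ge0.
exact: upar.
Qed.

Let shift_val_lp f : shift_val f \in lp_pred hp.
Proof.
rewrite inE; apply: le_lt_trans (shift_val_lp_sum f) _.
by rewrite lte_mul_pinfty ?lp_fin// lee_fin powR_ge0.
Qed.

(** When the weights of the children of every vertex sum to at most [B], the value
    of the shift at [v] is at most [B] times the supremum of [|f|] over the
    children of [v], hence at most [B] times the norm of the restriction of [f]
    to these children. Different vertices have disjoint sets of children, so
    these restrictions add up and the shift is bounded by [B]. *)
Lemma shift_exists : exists T : X -> X,
  is_backward_shift E (fun u => (w u)%:C) T /\ bounded_operator T.
Proof.
exists (fun f => Lp (shift_val_lp f)); split.
  by move=> f v; apply/usum_limP; exact: shift_valP.
split.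
  move=> a f g; apply: lp_ext => v; rewrite lpD lpZ /=.
  apply: usum_lim_unique (shift_valP _ _) _.
  apply: usum_lim_ext (usum_limD (usum_limZ a (shift_valP f v)) (shift_valP g v)).
  move=> u; rewrite !termE; case: ifP => _; rewrite ?mulr0 ?addr0//.
  by rewrite lpD lpZ; ring.
exists B => f; rewrite !nrm_normr -rmorphM /= lecR.
apply: nrm_le; first by rewrite mulr_ge0 ?nrm_ge0.
by rewrite powRM ?nrm_ge0// EFinM -lp_sum_nrm; exact: shift_val_lp_sum.
Qed.

End ShiftExistence.

(** * A criterion for mixing *)

Section MixingCriterion.
Context {R : realType} {A : countType} {p : R} {hp : 1 < p}.
Local Notation X := (lp A hp).
Context (E : rel A) (treeE : directed_tree E) (r : A) (rr : is_root E r).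
Context (lam : A -> R[i]) (T : X -> X).
Hypotheses (BT : is_backward_shift E lam T) (bT : bounded_operator T).
Hypothesis lam0 : weight lam.

(** Small preimages of the unit vectors under all late iterates are the half of
    mixing that depends on the weights; the other half is [iter_low]. *)
Definition liftable v := forall e : R, 0 < e -> exists N, forall n, (N <= n)%N ->
  exists2 g : X, iter n T g = delta v & nrm g < e.

Lemma liftable_parent v u : E v u -> liftable u -> liftable v.
Proof.
move=> vu lu e e0.
have l0 : 0 < normc (lam u).
  rewrite lt_def normc_ge0 andbT; apply: contra_neq (lam0 u).
  exact: eq0_normc.
have [|N HN] := lu (e * normc (lam u)); first by rewrite mulr_gt0.
exists N.+1 => -[//|n] Nn; have [g gE gs] := HN n Nn.
exists ((lam u)^-1 *: g).
  rewrite iterS (iterZ bT) gE -[_ *: _]addr0 (shift_linear bT).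
  have /= -> := iter0 bT 1.
  rewrite (shift_delta treeE BT vu) addr0 scalerA mulVf ?(lam0 u)//.
  by rewrite scale1r.
by rewrite nrmZ normcV mulrC ltr_pdivrMr.
Qed.

Lemma liftable_ancestor v u : descendant E v u -> liftable u -> liftable v.
Proof.
move=> [n]; elim: n u => [|n IH] u; first by move=> /= ->.
by move=> [x vx xu] lu; apply: IH vx _; exact: liftable_parent xu lu.
Qed.

Lemma liftable_sum (s : seq A) (c : A -> R[i]) : (forall v, liftable v) ->
  forall e : R, 0 < e -> exists N, forall n, (N <= n)%N ->
  exists2 g : X, iter n T g = \sum_(v <- s) c v *: delta v & nrm g < e.
Proof.
move=> lft; elim: s => [|v s IH] e e0.
  by exists 0%N => n _; exists 0; rewrite ?big_nil ?(iter0 bT)// nrm0.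
have e20 : 0 < e / 2 by rewrite divr_gt0.
have [N1 H1] := IH _ e20.
have c0 : 0 < normc (c v) + 1 by rewrite ltr_wpDl ?normc_ge0.
have [|N2 H2] := lft v (e / 2 / (normc (c v) + 1)); first by rewrite divr_gt0.
exists (maxn N1 N2) => n; rewrite geq_max => /andP[/H1[g1 g1E g1s] /H2[g2 g2E g2s]].
exists (c v *: g2 + g1); first by rewrite (iter_linear bT) g1E g2E big_cons.
rewrite (splitr e); apply: le_lt_trans (nrmD _ _) _; rewrite nrmZ.
apply: ler_ltD => //; move: g2s; rewrite ltr_pdivlMr// => /ltW h.
by apply: le_trans h; rewrite mulrC ler_wpM2l ?nrm_ge0// lerDl.
Qed.

Lemma finite_support_dies (s : seq A) (c : A -> R[i]) : exists N, forall n,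
  (N <= n)%N -> iter n T (\sum_(v <- s) c v *: delta v) = 0.
Proof.
exists (\max_(v <- s) (dep E r v).+1)%N => n Nn.
rewrite (iter_sum bT) big_seq big1// => v vs.
rewrite (iterZ bT) (iter_low treeE rr BT) ?scaler0// => u nu.
rewrite deltaE; case: eqVneq nu => // -> nv; exfalso.
have := leq_trans Nn nv; rewrite leqNgt => /negP; apply.
by rewrite (@leq_bigmax_seq _ s predT (fun v => (dep E r v).+1)).
Qed.

(** Approximate the centres of the two open sets by finitely supported vectors.
    A late iterate kills the first one, and a small preimage of the second one
    added to it stays in the first open set. *)
Lemma mixing_of_liftable : (forall v, liftable v) -> mixing T.
Proof.
move=> lft U W oU [f Uf] oW [h Wh].
have [e1 e10 HU] := open_nrm oU Uf; have [e2 e20 HW] := open_nrm oW Wh.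
have e120 : 0 < e1 / 2 by rewrite divr_gt0.
have [s us] := finite_approx f e120; rewrite nrmB => fs.
have [t ut] := finite_approx h e20; rewrite nrmB => ht.
have [N1 H1] := finite_support_dies s f.
have [N2 H2] := liftable_sum t h lft e120.
exists (maxn N1 N2) => n; rewrite geq_max => /andP[/H1 fn /H2[g gE gs]].
exists (\sum_(v <- t) h v *: delta v); split.
  exists (\sum_(v <- s) f v *: delta v + g); last by rewrite (iterD bT) fn add0r.
  apply: HU; rewrite addrAC (splitr e1).
  exact: le_lt_trans (nrmD _ _) (ltrD fs gs).
exact: HW.
Qed.

Context (Lam : A -> R[i]).
Hypotheses (Lam0 : forall v, Lam v != 0)
  (LamE : forall u v, E u v -> Lam v = lam v * Lam u).

Lemma lift_ray n v u : Chin E n v u ->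
  exists2 g : X, iter n T g = delta v & nrm g = normc (Lam v) / normc (Lam u).
Proof.
move=> vu; exists ((Lam v / Lam u) *: delta u).
  rewrite (iterZ bT) (iter_delta treeE BT bT Lam0 LamE vu) scalerA.
  have := Lam0 v; have := Lam0 u => u0 v0.
  rewrite (_ : _ * _ = 1) ?scale1r//; by field; apply/andP.
by rewrite nrmZ nrm_delta mulr1 normcM normcV.
Qed.

(** If [K] vertices of the [n]-th generation of [v] have the same cumulative
    weight as [v], then suitable coefficients of modulus [1 / K] on them give a
    preimage of [delta v] of norm [K ^ (1/p - 1)]. This tends to 0 because [p > 1],
    although no single cumulative weight grows. *)
Lemma lift_average n v (s : seq A) : uniq s -> s != [::] ->
  (forall u, u \in s -> Chin E n v u) ->
  (forall u, u \in s -> normc (Lam u) = normc (Lam v)) ->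
  exists2 g : X, iter n T g = delta v & nrm g = (size s)%:R `^ (p^-1 - 1).
Proof.
move=> us sN sC sL.
have p0 : 0 < p by exact: lt_trans hp.
have K0 : 0 < (size s)%:R :> R by rewrite ltr0n; case: (s) sN.
have K0' : (size s)%:R != 0 :> R[i] by rewrite pnatr_eq0; case: (s) sN.
pose c u := Lam v / Lam u / (size s)%:R.
exists (\sum_(u <- s) c u *: delta u).
  rewrite (iter_sum bT) big_seq (eq_bigr (fun=> (size s)%:R^-1 *: delta v)).
    rewrite -big_seq big_const_seq count_predT iter_addr_0.
    by rewrite scalerMnl -[_ *+ _]mulr_natr mulVf ?scale1r.
  move=> u us'; rewrite (iterZ bT) (iter_delta treeE BT bT Lam0 LamE (sC _ us')).
  rewrite scalerA; congr (_ *: _); rewrite /c.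
  have := Lam0 v; have := Lam0 u => u0 v0.
  by field; rewrite u0 v0 K0'.
rewrite (@nrm_finite _ _ _ _ s)//; last first.
  by move=> u /negPf us'; rewrite sum_deltaE// us'.
rewrite (_ : \sum_(u <- s) _ = \sum_(u <- s) (size s)%:R `^ (- p)); last first.
  apply: eq_big_seq => u us'; rewrite sum_deltaE// us' /c.
  have nL : normc (Lam v) != 0 by apply: contra_neq (Lam0 v); exact: eq0_normc.
  rewrite !normcM !normcV sL// divff// mul1r.
  rewrite (_ : normc _ = (size s)%:R); last first.
    by rewrite -(rmorph_nat (real_complex R)) normc_real ger0_norm.
  by rewrite -powR_inv1 ?ltW// -powRrM mulN1r.
rewrite big_const_seq count_predT iter_addr_0 -[X in X `^ p^-1]mulr_natl.
rewrite -[X in X * _]powRr1 ?ltW// -powRD; last by rewrite (gt_eqF K0) implybT.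
rewrite -powRrM; congr (_ `^ _); by field; rewrite gt_eqF.
Qed.

End MixingCriterion.

(** * Masses capped below a vertex exclude hypercyclic algebras *)

Section FertileWeight.
Context {R : realType} {A : countType}.
Context (E : rel A) (treeE : directed_tree E) (r : A) (rr : is_root E r).
Context (lE : leafless E) (v0 : A).

Definition child1 v : A := projT1 (cid (lE v)).
Lemma child1P v : E v (child1 v). Proof. by rewrite /child1; case: cid. Qed.

(** It equals [child1 v] when [v] has only one child. *)
Definition child2 v : A := xget (child1 v) [set u | E v u /\ u != child1 v].

Lemma child2_neq v u : E v u -> u != child1 v ->
  E v (child2 v) /\ child2 v != child1 v.
Proof.
by move=> vu uN; rewrite /child2; case: xgetP => [w _ //|/(_ u)[]].
Qed.

(** The first child doubles the mass of its parent, the second one preserves it,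
    and the others receive a summable share, so that the factors of all the
    children of a vertex stay bounded even for infinitely many children. *)
Definition factor u : R :=
  if u == child1 (par E u) then 2
  else if u == child2 (par E u) then 1 else 2^-1 ^+ choice.pickle u.

Lemma factor_gt0 u : 0 < factor u.
Proof. by rewrite /factor; case: ifP => // _; case: ifP => // _; rewrite exprn_gt0. Qed.

Lemma geometric_bound n : \sum_(i <- iota 0 n) 2^-1 ^+ i <= 2 :> R.
Proof.
suff -> : \sum_(i <- iota 0 n) 2^-1 ^+ i = 2 - 2 * 2^-1 ^+ n :> R.
  by rewrite gerBl mulr_ge0// exprn_ge0.
elim: n => [|n IH]; first by rewrite big_nil expr0 mulr1 subrr.
by rewrite -addn1 iotaD big_cat /= IH big_seq1 add0n addn1 exprS; field.
Qed.

Lemma factor_sum v (F : {fset A}) : \sum_(u <- F | E v u) factor u <= 5.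
Proof.
have one a : \sum_(u <- F) (u == a)%:R <= 1 :> R.
  apply: le_trans (_ : \sum_(u <- a :: rem a F) (u == a)%:R <= _).
    apply: ler_sum_sub => // [|u uF].
    - by rewrite /= mem_rem_uniq ?fset_uniq// inE eqxx/= rem_uniq// fset_uniq.
    - by rewrite inE mem_rem_uniq ?fset_uniq// inE; case: eqP.
  rewrite big_cons eqxx big_seq big1 ?addr0// => u.
  by rewrite mem_rem_uniq ?fset_uniq// inE => /andP[/negPf ->].
have geo : \sum_(u <- F) 2^-1 ^+ choice.pickle u <= 2 :> R.
  have -> : \sum_(u <- F) 2^-1 ^+ choice.pickle u =
      \sum_(i <- map choice.pickle F) 2^-1 ^+ i :> R by rewrite big_map.
  apply: le_trans (geometric_bound (\max_(i <- map choice.pickle F) i.+1)).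
  apply: ler_sum_sub => [||i iF|i]; last by rewrite exprn_ge0.
  - by rewrite map_inj_uniq ?fset_uniq//; exact: (pcan_inj choice.pickleK).
  - exact: iota_uniq.
  - by rewrite mem_iota /= add0n (@leq_bigmax_seq _ _ predT succn).
apply: le_trans (_ : \sum_(u <- F) (2 * (u == child1 v)%:R +
    ((u == child2 v)%:R + 2^-1 ^+ choice.pickle u)) <= _).
  rewrite [leLHS]big_mkcond /=; apply: ler_sum => u _.
  have k0 : 0 <= 2^-1 ^+ choice.pickle u :> R by rewrite exprn_ge0.
  case: ifPn => [vu|_]; last first.
    by rewrite !addr_ge0// mulr_ge0.
  rewrite /factor (parE treeE vu); case: eqP => _ /=.
    by rewrite mulr1 lerDl addr_ge0.
  by rewrite mulr0 add0r; case: eqP => _ /=; rewrite ?lerDl ?add0r.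
rewrite !big_split /= -mulr_sumr.
have := one (child1 v); have := one (child2 v); move: geo; lra.
Qed.

(** The mass [m] is the cumulative weight of the shift to be built: it is
    multiplied by [factor] along the edges, but below [v0] it is capped at 1. *)
Lemma fertile_mass : exists m : A -> R,
  [/\ (forall u, 0 < m u),
      (forall u, descendant E v0 u -> m u <= 1),
      (forall u v, E u v -> descendant E v0 v ->
        m v = Num.min 1 (factor v * m u)),
      (forall u v, E u v -> ~ descendant E v0 v -> m v = factor v * m u)
    & (forall u v, E u v -> m v <= factor v * m u)].
Proof.
pose F v (x : R) := if `[< descendant E v0 v >] then Num.min 1 (factor v * x)
                    else factor v * x.
have [m [mr mE]] := tree_rec treeE rr 1 F.
have mD u v : E u v -> descendant E v0 v -> m v = Num.min 1 (factor v * m u).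
  by move=> uv Dv; rewrite (mE _ _ uv) /F; case: asboolP.
have mN u v : E u v -> ~ descendant E v0 v -> m v = factor v * m u.
  by move=> uv Dv; rewrite (mE _ _ uv) /F; case: asboolP.
exists m; split=> //.
- apply: (tree_ind treeE rr) => [|u v uv mu]; first by rewrite mr.
  rewrite (mE _ _ uv) /F; have := mulr_gt0 (factor_gt0 v) mu.
  by case: asboolP => // _ fm; rewrite lt_min ltr01.
- move=> u Du; have [->|[w wu]] := root_or_child treeE rr u; first by rewrite mr.
  by rewrite (mD _ _ wu Du) ge_min lexx.
- move=> u v uv; rewrite (mE _ _ uv) /F; case: asboolP => // _.
  by rewrite ge_min lexx orbT.
Qed.

End FertileWeight.

Section FertileShift.
Context {R : realType} {A : countType} {p : R} {hp : 1 < p}.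
Local Notation X := (lp A hp).
Context (E : rel A) (treeE : directed_tree E) (r : A) (rr : is_root E r).
Context (lE : leafless E) (v0 : A).

Section BoundedMass.
Context (w m : A -> R) (T : X -> X).
Hypotheses (m0 : forall u, 0 < m u) (mE : forall u v, E u v -> m v = w v * m u)
  (BT : is_backward_shift E (fun u => (w u)%:C) T).

(** At [v], the [n]-th iterate is the sum of the values of [g] over the [n]-th
    generation with coefficients [m u / m v]. *)
Lemma iter_mass_bound (g : X) n v : ((m v * normc (iter n T g v))%:E <=
  \esum_(u in Chin E n v) (m u * normc (g u))%:E)%E.
Proof.
have pos u : (0 <= (m u * normc (g u))%:E)%E.
  by rewrite lee_fin mulr_ge0 ?normc_ge0// ltW.
elim: n v => [|n IH] v; first by rewrite esum_set1.
set S := (esum _ _); have [Sfin|] := boolP (S \is a fin_num); last first.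
  by rewrite ge0_fin_numE ?esum_ge0// -leNgt leye_eq => /eqP ->; rewrite leey.
rewrite -(fineK Sfin) lee_fin -ler_pdivlMl//.
have /usum_limP ul := @BT (iter n T g) v.
apply: (usum_lim_bound _ ul) => F.
rewrite ler_pdivlMl// -lee_fin (fineK Sfin).
apply: le_trans (_ : (\sum_(u <- F | E v u) \esum_(t in Chin E n u)
    (m t * normc (g t))%:E <= _)%E).
  apply: le_trans (_ : (\sum_(u <- F | E v u)
     (m u * normc (iter n T g u))%:E <= _)%E); last by apply: lee_sum => u _.
  rewrite sumEFin lee_fin [leRHS]big_mkcond /=.
  apply: le_trans (ler_wpM2l (ltW (m0 v)) (normc_sum _ _ _)) _.
  rewrite mulr_sumr; apply: ler_sum => u _; rewrite /patch.
  case: ifPn => [/set_mem /= vu|].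
    rewrite vu normcM normc_real gtr0_norm.
      by rewrite (mE vu) mulrA (mulrC (m v)).
    by rewrite -(pmulr_lgt0 _ (m0 v)) -mE.
  move=> _; case: ifP => _; rewrite normc0 mulr0 // mulr_ge0 ?normc_ge0//.
  exact: ltW.
rewrite -big_filter fsbig_seq ?filter_uniq ?fset_uniq//=.
rewrite -esum_fset; [|exact: finite_seq|by move=> ? _; exact: esum_ge0].
apply: esum_fibres_le => // [i j t|u].
  exact: (Chin_inj (tree_upar treeE)).
rewrite /= mem_filter => /andP[vu _] t ut.
by have := Chin_cat (Chin1 vu) ut; rewrite add1n.
Qed.

(** A high power [g] of an element of the algebra is absolutely summable. As the
    mass is at most 1 below [v0], the numbers [iter n T g v0] are bounded in
    [n], so that the orbit of [g] is not dense. *)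
Lemma no_hypercyclic_algebra : (forall u, descendant E v0 u -> m u <= 1) ->
  ~ exists S : set X, hypercyclic_algebra T S.
Proof.
have p0 : 0 < p by exact: lt_trans hp.
move=> m1 [S [[S0 SD SZ SM] SN0 hcS]].
have [f [Sf fN0]] : exists f, S f /\ f != 0.
  apply: contrapT => h; move: SN0 => /eqP; apply; apply/seteqP; split=> x /=.
    by move=> Sx; apply: contrapT => /eqP xN0; apply: h; exists x.
  by move->.
(* With values of modulus at most 1, the powers of [f] of degree at least [p]
   are dominated by the [p]-th power of its modulus. *)
wlog f1 : f Sf fN0 / nrm f <= 1.
  move=> h; have f0 : 0 < nrm f.
    by rewrite lt_def nrm_ge0 andbT; apply: contra_neq fN0; exact: nrm_eq0.
  apply: (h (((nrm f)^-1)%:C *: f)); first exact: SZ.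
    by rewrite scaler_eq0 negb_or fN0 andbT fmorph_eq0 invr_eq0 gt_eqF.
  by rewrite nrmZ normc_real gtr0_norm ?invr_gt0// mulVf// gt_eqF.
pose pw := fix pw k := if k is j.+1 then lp_mul f (pw j) else f.
have pwE k v : pw k v = f v ^+ k.+1.
  by elim: k => [//|k IH]; rewrite exprS -IH.
have Spw k : S (pw k) by elim: k => // k IH; exact: SM.
have pwN0 k : pw k != 0.
  apply: contra_neq fN0 => pw0; apply: lp_ext => v.
  have := congr1 (fun h : X => h v) pw0; rewrite pwE lp0 => /eqP.
  by rewrite expf_eq0 /= => /eqP.
have [k kp] : exists k : nat, p <= k.+1%:R.
  exists (Num.truncn p); apply: ltW; exact: truncnS_gt.
set g := pw k.
have gle v : normc (g v) <= normc (f v) `^ p.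
  have nf := normc_ge0 (f v).
  have nf1 : normc (f v) <= 1 by apply: le_trans f1; exact: normc_le_nrm.
  rewrite pwE normcX -powR_mulrn//.
  have [->|fv0] := eqVneq (normc (f v)) 0; first by rewrite !powR0 ?gt_eqF.
  have e0 : 0 <= k.+1%:R - p by rewrite subr_ge0.
  rewrite -[k.+1%:R](subrK p) powRD; last by rewrite (negPf fv0) implybT.
  rewrite ler_piMl ?powR_ge0//.
  apply: le_trans (_ : _ <= 1 `^ (k.+1%:R - p)) _; last by rewrite powR1.
  by rewrite ge0_ler_powR// nnegrE.
set C := fine (lp_sum p f) / m v0.
have bnd n : normc (iter n T g v0) <= C.
  rewrite /C ler_pdivlMr// -lee_fin fineK; last first.
    by rewrite lp_sum_nrm.
  rewrite mulrC; apply: le_trans (iter_mass_bound g n v0) _.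
  apply: le_trans (_ : _ <= \esum_(u in Chin E n v0) (normc (f u) `^ p)%:E)%E _.
    apply: le_esum => u vu; rewrite lee_fin; apply: le_trans (gle u).
    by rewrite ler_piMl ?normc_ge0// m1//; exists n.
  by apply: esum_subset => // u; rewrite lee_fin powR_ge0.
have C0 : 0 <= C by apply: le_trans (bnd 0%N); exact: normc_ge0.
have := hcS g (Spw k) (pwN0 k).
pose y : X := (C + 1)%:C *: delta v0.
move=> /(_ [set h | nrm (h - y) < 1]) [||h [/= hy [n _ nh]]].
- by exists y; rewrite /= subrr nrm0.
- exact: open_nrm_ball.
have := le_lt_trans (normc_le_nrm (h - y) v0) hy.
rewrite lpB lpZ deltaE eqxx mulr1 -nh => lt1.
have : normc ((C + 1)%:C : R[i]) <= normc ((C + 1)%:C - iter n T g v0) + normc (iter n T g v0).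
  by rewrite -{1}[(C + 1)%:C](subrK (iter n T g v0)) le_normcD.
rewrite normc_real ger0_norm ?addr_ge0// -normcN opprB => h1.
by have := le_lt_trans h1 (ltr_leD lt1 (bnd n)); rewrite addrC ltxx.
Qed.

End BoundedMass.

End FertileShift.

(** * A mixing shift below a fertile vertex *)

Section FertileConstruction.
Context {R : realType} {A : countType} {p : R} {hp : 1 < p}.
Local Notation X := (lp A hp).
Context (E : rel A) (treeE : directed_tree E) (r : A) (rr : is_root E r).
Context (lE : leafless E) (v0 : A) (fert : fertile E v0).

Let upar := @tree_upar _ E treeE.
Let c1 := child1 lE.
Let c2 := child2 lE.
(* On the subtree of first and second children the factors are at least 1, so a
   mass that has reached the cap 1 stays there. *)
Let two_children : rel A := fun u x => E u x && ((x == c1 u) || (x == c2 u)).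

Let Chin_child1 n v : Chin E n v (iter n c1 v).
Proof. by elim: n => [//|n IH]; exists (iter n c1 v) => //; exact: (child1P lE). Qed.

Let two_children_sub n v x : Chin two_children n v x -> Chin E n v x.
Proof. by elim: n x => [//|n IH] x [y /IH vy /andP[yx _]]; exists y. Qed.

(** Otherwise every vertex met by following first children from [w] would have
    an only child, and all the generations of [w] would be singletons. *)
Lemma fertile_branches w : descendant E v0 w ->
  exists2 u, descendant two_children w u & branches two_children u.
Proof.
move=> Dw; apply: contrapT => nobr.
have Dw' : (\bigcup_n Chin E n v0) w by case: Dw => n; exists n.
have [N _ HN] := @fert w Dw' 2%N.
apply: (card_ge2 (HN N (leqnn N)) (a := iter N c1 w)) => x wx.
suff [xE _] : x = iter N c1 w /\ descendant two_children w x by exact: xE.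
elim: N x wx {HN} => [|n IH] x; first by move=> /= ->; split => //; exists 0%N.
move=> [y /IH[yE [k wy]] yx].
have xc : x = c1 y.
  apply/eqP; apply: contrapT => /negP xN; apply: nobr; exists y; first by exists k.
  have [yc2 c2N] := child2_neq yx xN.
  exists (c2 y), (c1 y); split=> //; apply/andP; split=> //; rewrite ?eqxx ?orbT//.
  exact: (child1P lE).
split; first by rewrite xc yE.
by exists k.+1, y => //; apply/andP; split; rewrite ?xc ?eqxx//; exact: (child1P lE).
Qed.

Context (m : A -> R) (m0 : forall u, 0 < m u).
Hypothesis mD : forall u v, E u v -> descendant E v0 v ->
  m v = Num.min 1 (factor lE v * m u).
Hypothesis mN : forall u v, E u v -> ~ descendant E v0 v -> m v = factor lE v * m u.

Let factor_child1 u : factor lE (c1 u) = 2 :> R.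
Proof. by rewrite /factor (parE treeE (child1P lE u)) eqxx. Qed.

Let factor_two_children u x : two_children u x -> 1 <= factor lE x :> R.
Proof.
move=> /andP[ux xc]; rewrite /factor (parE treeE ux).
case: ifP => [_|/negP xN]; first by rewrite ler1n.
by case/orP: xc => [/xN//|->].
Qed.

Lemma mass_two_children v x : descendant E v0 v -> m v = 1 ->
  descendant two_children v x -> descendant E v0 x /\ m x = 1.
Proof.
move=> Dv mv [n]; elim: n x => [|n IH] x; first by move=> /= ->.
move=> [y /IH[Dy my] yx].
have Eyx : E y x by case/andP: yx.
have Dx := descendant_trans Dy (descendant1 Eyx); split => //.
by rewrite (mD Eyx Dx) my mulr1; apply/min_idPl; exact: factor_two_children yx.
Qed.

(** The mass doubles along first children until it meets the cap. *)
Lemma mass_saturates v : descendant E v0 v -> m v <= 1 ->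
  exists n, descendant E v0 (iter n c1 v) /\ m (iter n c1 v) = 1.
Proof.
move=> Dv mv1.
have Dn n : descendant E v0 (iter n c1 v).
  by apply: descendant_trans Dv _; exists n; exact: Chin_child1.
have mn n : m (iter n c1 v) = Num.min 1 (2 ^+ n * m v).
  elim: n => [|n IH]; first by rewrite expr0 mul1r; apply/esym/min_idPr.
  rewrite iterS (mD (child1P lE _) (Dn n.+1)) factor_child1 IH exprS.
  rewrite !minEle; have [h|h] := leP 1 (2 ^+ n * m v).
    have h' : 1 <= 2 * 2 ^+ n * m v by rewrite -mulrA; lra.
    by rewrite h' mulr1 ler1n.
  by rewrite mulrA.
exists (Num.truncn (m v)^-1).+1; split=> //; rewrite mn; apply/min_idPl.
rewrite -ler_pdivrMr// mul1r; apply: le_trans (ltW (truncnS_gt _)) _.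
by rewrite -natrX ler_nat; apply: ltnW; exact: ltn_expl.
Qed.

Lemma mass_doubles v n : (forall u, descendant E v u -> ~ descendant E v0 u) ->
  m (iter n c1 v) = 2 ^+ n * m v.
Proof.
move=> nD; elim: n => [|n IH]; first by rewrite mul1r.
rewrite iterS (mN (child1P lE _)) ?factor_child1 ?IH ?exprS ?mulrA//.
by apply: nD; exists n.+1; exact: Chin_child1.
Qed.

Lemma exists_small_power (e : R) : 0 < e ->
  exists2 K : nat, (0 < K)%N & K%:R `^ (p^-1 - 1) < e.
Proof.
move=> e0; set a := 1 - p^-1.
have a0 : 0 < a by rewrite subr_gt0 invf_lt1// (lt_trans _ hp).
exists (Num.truncn ((e^-1) `^ a^-1)).+1 => //.
set K := _.+1; have K0 : 0 < K%:R :> R by rewrite ltr0n.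
have -> : p^-1 - 1 = - a by rewrite opprB.
rewrite powRN -[e]invrK.
rewrite ltf_pV2 ?posrE ?invr_gt0 ?powR_gt0//.
have -> : e^-1 = (e^-1 `^ a^-1) `^ a.
  by rewrite -powRrM mulVf ?gt_eqF// powRr1// invr_ge0 ltW.
apply: gt0_ltr_powR => //; rewrite ?nnegrE ?powR_ge0//; exact: truncnS_gt.
Qed.

Context (lam : A -> R[i]) (T : X -> X).
Hypotheses (BT : is_backward_shift E lam T) (bT : bounded_operator T).
Hypotheses (lam0 : weight lam)
  (mE : forall u v, E u v -> (m v)%:C = lam v * (m u)%:C).

Let Lam0 v : (m v)%:C != 0.
Proof. by rewrite fmorph_eq0 gt_eqF. Qed.

(** Below a descendant of [v0] of mass 1, the subtree of first and second
    children has mass 1 throughout and its generations grow without bound, so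
    averages over them have small norm. *)
Lemma liftable_saturated v : descendant E v0 v -> m v = 1 -> liftable T v.
Proof.
move=> Dv mv e e0; have [K K0 Ke] := exists_small_power e0.
have upar' a a' b : two_children a b -> two_children a' b -> a = a'.
  by move=> /andP[ab _] /andP[a'b _]; exact: upar ab a'b.
have lE' : leafless two_children.
  by move=> u; exists (c1 u); rewrite /two_children eqxx andbT; exact: (child1P lE).
have [|N HN] := branching_growth upar' lE' K (v := v).
  by move=> w /(mass_two_children Dv mv)[Dw _]; exact: fertile_branches.
exists N => n /HN[s [us ss sC]].
have [|||g gE gn] := @lift_average _ _ _ _ _ treeE _ _ BT bT _ Lam0 mE n v s us.
- by case: (s) ss K0 => //= <-.
- by move=> u /sC; exact: two_children_sub.
- move=> u /sC vu; rewrite mv.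
  by have [_ ->] := mass_two_children Dv mv (ex_intro _ n vu).
- by exists g => //; rewrite gn ss.
Qed.

(** A vertex with some descendant below [v0] inherits liftability from a
    saturated vertex. For any other vertex the mass doubles forever along the
    first children. *)
Lemma liftable_all (m1 : forall u, descendant E v0 u -> m u <= 1) v : liftable T v.
Proof.
have liftD u : descendant E v0 u -> liftable T u.
  move=> Du; have [n [Dn mn]] := mass_saturates Du (m1 u Du).
  apply: (liftable_ancestor treeE BT bT lam0 _ (liftable_saturated Dn mn)).
  by exists n; exact: Chin_child1.
have [[u [vu Du]]|nD] := pselect (exists u, descendant E v u /\ descendant E v0 u).
  exact: (liftable_ancestor treeE BT bT lam0 vu (liftD u Du)).
have {}nD u : descendant E v u -> ~ descendant E v0 u.
  by move=> vu Du; apply: nD; exists u.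
move=> e e0; exists (Num.truncn e^-1).+1 => n Nn.
have [g gE gn] := lift_ray treeE BT bT Lam0 mE (Chin_child1 n v).
exists g => //; rewrite gn !normc_real !gtr0_norm// (mass_doubles _ nD).
rewrite invfM mulrCA divff ?gt_eqF// mulr1.
rewrite -[e]invrK ltf_pV2 ?posrE ?invr_gt0 ?exprn_gt0//.
apply: lt_le_trans (truncnS_gt _) _.
by rewrite -natrX ler_nat (leq_trans Nn)// ltnW// ltn_expl.
Qed.

End FertileConstruction.

Lemma fertile_mixing_shift (R : realType) (A : countType) (E : rel A)
    (p : R) (hp : 1 < p) (v0 : A) :
  directed_tree E -> rooted E -> leafless E -> fertile E v0 ->
  exists lam : A -> R[i], weight lam /\
    exists T : lp A hp -> lp A hp,
      [/\ is_backward_shift E lam T, bounded_operator T, mixing T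
        & ~ exists S : set (lp A hp), hypercyclic_algebra T S].
Proof.
move=> treeE [r rr] lE fert.
have [m [m0 m1 mD mN mle]] := @fertile_mass R _ _ treeE _ rr lE v0.
pose w u := m u / m (par E u).
have w0 u : 0 < w u by rewrite divr_gt0.
have mE u v : E u v -> m v = w v * m u.
  by move=> uv; rewrite /w (parE treeE uv) divfK// gt_eqF.
have wB v (F : {fset A}) : \sum_(u <- F | E v u) w u <= 5.
  apply: le_trans (factor_sum treeE lE v F); apply: ler_sum => u vu.
  by rewrite /w (parE treeE vu) ler_pdivrMr//; exact: mle.
have [T [BT bT]] := @shift_exists _ _ _ hp E (tree_upar treeE) w 5
  (fun u => ltW (w0 u)) (ler0n _ 5) wB.
have lam0 : weight (fun u => (w u)%:C).
  by move=> u; rewrite fmorph_eq0 gt_eqF.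
exists (fun u => (w u)%:C); split=> //; exists T; split=> //.
  apply: (mixing_of_liftable treeE rr BT bT) => v.
  apply: (liftable_all treeE fert m0 mD mN BT bT lam0 _ m1) => u x ux.
  by rewrite -rmorphM /= -mE.
exact: (no_hypercyclic_algebra treeE m0 mE BT m1).
Qed.

(** * Escaping rays, dense targets and sums of blocks *)

(** Were there a branching vertex below every descendant of [v], all these
    descendants would have growing generations and [v] would be fertile. *)
Lemma barren_descendant (A : countType) (E : rel A) (v : A) :
  (forall a a' b, E a b -> E a' b -> a = a') -> leafless E ->
  ~ fertile E v -> exists2 w, descendant E v w &
    forall u, descendant E w u -> ~ branches E u.
Proof.
move=> upar lE nf; apply: contrapT => nw; apply: nf => w [j _ vw] K.
have [|N HN] := branching_growth upar lE K (v := w).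
  move=> x wx; apply: contrapT => nx; apply: nw; exists x.
    by apply: descendant_trans wx; exists j.
  by move=> u xu bu; apply: nx; exists u.
exists N => // n /= /HN[s [us <- sC]]; exact: card_ge_seq us sC.
Qed.

Section EscapingRays.
Context {R : realType} {A : countType} {p : R} {hp : 1 < p}.
Local Notation X := (lp A hp).
Context (E : rel A) (treeE : directed_tree E) (lE : leafless E).
Context (lam : A -> R[i]) (T : X -> X).
Hypotheses (BT : is_backward_shift E lam T) (bT : bounded_operator T).
Context (Lam : A -> R[i]).
Hypotheses (Lam0 : forall v, Lam v != 0)
  (LamE : forall u v, E u v -> Lam v = lam v * Lam u).

(** The value at [w] of the [n]-th iterate of [f] only depends on the value of [f]
    at the end of the ray. Mixing moves some vector of norm less than [e] close
    to [delta w], so this single coefficient must be at least of order [1 / e]. *)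
Lemma barren_ray_escapes w (C : R) : mixing T ->
  (forall u, descendant E w u -> ~ branches E u) ->
  exists N, forall n, (N <= n)%N -> C <= normc (Lam (iter n (child1 lE) w)).
Proof.
move=> mixT nb; wlog C0 : C / 0 < C.
  move=> h; have [|N HN] := h (Num.max C 1); first by rewrite lt_max ltr01 orbT.
  by exists N => n /HN; rewrite ge_max => /andP[].
have L0 v : 0 < normc (Lam v).
  by rewrite lt_def normc_ge0 andbT; apply: contra_neq (Lam0 v); exact: eq0_normc.
pose e := normc (Lam w) / (2 * C).
have e0 : 0 < e by rewrite divr_gt0// mulr_gt0.
have [||N HN] := @mixT _ _ (@open_nrm_ball _ _ _ hp 0 e) _
  (@open_nrm_ball _ _ _ hp (delta w) 2^-1) _.
- by exists 0; rewrite /= subrr nrm0.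
- by exists (delta w); rewrite /= subrr nrm0.
exists N => n /HN[h [[f fe fh] hw]]; move: fe hw; rewrite /= subr0 -{}fh => fe hw.
have D k : descendant E w (iter k (child1 lE) w).
  exists k; elim: k => [//|k IH]; exists (iter k (child1 lE) w) => //.
  exact: (child1P lE).
have ray := @iter_ray _ _ _ _ _ _ _ BT _ Lam0 LamE (fun k => iter k (child1 lE) w) n f.
have {}ray : iter n T f w = Lam (iter n (child1 lE) w) / Lam w * f (iter n (child1 lE) w).
  apply: ray => [k|k x kx]; first exact: (child1P lE).
  apply: contrapT => /eqP xN; apply: (nb _ (D k)); exists x, (iter k.+1 (child1 lE) w).
  by split=> //; exact: (child1P lE).
move: ray; set z := iter n (child1 lE) w => ray.
have fz : normc (f z) <= e by apply: le_trans (normc_le_nrm f z) (ltW fe).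
have half : 2^-1 <= normc (iter n T f w).
  have := le_lt_trans (normc_le_nrm _ w) hw; rewrite lpB deltaE eqxx => h1.
  have : normc (1 : R[i]) <= normc (iter n T f w - 1) + normc (iter n T f w).
    by rewrite -(normcN (_ - _)) opprB -{1}[1](subrK (iter n T f w)) le_normcD.
  rewrite normc1 => h2; have h3 := le_lt_trans h2 (ltr_leD h1 (lexx _)).
  by apply: ltW; move: h3; rewrite [X in X < _](splitr 1) !mul1r ltrD2l.
have : 2^-1 <= normc (Lam z) / normc (Lam w) * e.
  apply: le_trans half _; rewrite ray !normcM normcV ler_wpM2l//.
  by rewrite divr_ge0 ?normc_ge0.
rewrite /e mulrA divfK ?gt_eqF// ler_pdivlMr ?mulr_gt0//.
by rewrite mulrA mulVf// mul1r.
Qed.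

Lemma escaping_ray v : mixing T -> (forall u, ~ fertile E u) ->
  exists ray : nat -> A, (forall n, Chin E n v (ray n)) /\
    forall C, exists N, forall n, (N <= n)%N -> C <= normc (Lam (ray n)).
Proof.
move=> mixT nf; have upar := tree_upar treeE.
have [w [d vw] nb] := barren_descendant upar lE (nf v).
have ChinC n u : Chin E n u (iter n (child1 lE) u).
  by elim: n => [//|n IH]; exists (iter n (child1 lE) u) => //; exact: (child1P lE).
exists (fun n => if (n < d)%N then iter n (child1 lE) v else iter (n - d) (child1 lE) w).
split=> [n|C].
  by case: ltnP => // dn; rewrite -{1}(subnKC dn); exact: Chin_cat vw _.
have [N HN] := barren_ray_escapes C mixT nb.
exists (N + d)%N => n Nn; rewrite ltnNge (leq_trans (leq_addl _ _) Nn) /=.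
by apply: HN; lia.
Qed.

End EscapingRays.

Section RationalTargets.
Context {R : realType} {A : countType} {p : R} {hp : 1 < p}.
Local Notation X := (lp A hp).

Definition rat_complex (q : rat * rat) : R[i] := ratr q.1 +i* ratr q.2.

Definition rat_vector (s : seq (A * (rat * rat))) : X :=
  \sum_(q <- s) rat_complex q.2 *: delta q.1.

Definition rat_support (s : seq (A * (rat * rat))) : seq A := undup (map fst s).

Lemma rat_vectorE s :
  rat_vector s = \sum_(v <- rat_support s) rat_vector s v *: delta v.
Proof.
apply: lp_ext => u; rewrite sum_deltaE ?undup_uniq//; case: ifPn => //.
rewrite mem_undup => uN; rewrite lp_sumrE big_seq big1// => q qs.
rewrite lpZ deltaE; case: eqVneq => [uq|]; last by rewrite mulr0.
by move: uN; rewrite uq map_f.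
Qed.

Lemma rat_complex_dense (z : R[i]) (e : R) : 0 < e ->
  exists q, normc (z - rat_complex q) < e.
Proof.
move=> e0; case: z => a b.
have approx (c : R) : exists q : rat, `|c - ratr q| < e / 2.
  have [|q] := @rat_in_itvoo R (c - e / 2) (c + e / 2).
    by rewrite ltrBlDr -addrA ltrDl addr_gt0// divr_gt0.
  by rewrite in_itv /= => /andP[h1 h2]; exists q; rewrite distrC ltr_distl h1.
have [qa ha] := approx a; have [qb hb] := approx b.
exists (qa, qb).
have -> : (a +i* b - rat_complex (qa, qb)) =
   (a - ratr qa)%:C + 'i%C * (b - ratr qb)%:C.
  by rewrite [LHS]complexE.
rewrite (splitr e); apply: le_lt_trans (le_normcD _ _) _.
apply: ltrD; rewrite ?normcM normc_real//.
suff -> : normc ('i%C : R[i]) = 1 by rewrite mul1r.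
by rewrite /normc /= expr0n add0r expr1n sqrtr1.
Qed.

Lemma rat_vector_dense (y : X) (e : R) : 0 < e -> exists s, nrm (y - rat_vector s) < e.
Proof.
move=> e0; have e20 : 0 < e / 2 by rewrite divr_gt0.
have [t _ ht] := finite_approx y e20.
suff [s hs] : exists s, nrm (\sum_(v <- t) y v *: delta v - rat_vector s) < e / 2.
  exists s; rewrite (splitr e); apply: le_lt_trans (ltrD ht hs).
  by apply: le_trans (nrmD _ _); rewrite addrA subrK.
elim: t {ht} (e / 2) e20 => [|v t IH] d d0.
  by exists [::]; rewrite /rat_vector !big_nil subrr nrm0.
have d20 : 0 < d / 2 by rewrite divr_gt0.
have [s hs] := IH _ d20; have [q hq] := rat_complex_dense (y v) d20.
exists ((v, q) :: s); rewrite /rat_vector !big_cons opprD addrACA (splitr d).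
apply: le_lt_trans (nrmD _ _) _; apply: ltrD hs.
by rewrite -scalerBl nrmZ nrm_delta mulr1.
Qed.

End RationalTargets.

(** The exponent of 2 in [k.+1] encodes the value; multiplying by powers of 3
    produces arbitrarily late occurrences of it. *)
Lemma recurrent_enumeration (I : countType) (i0 : I) : exists t : nat -> I,
  forall i N, exists2 k, (N <= k)%N & t k = i.
Proof.
exists (fun k => odflt i0 (choice.unpickle (logn 2 k.+1))) => i N.
exists (2 ^ choice.pickle i * 3 ^ N).-1.
  rewrite -ltnS prednK ?muln_gt0 ?expn_gt0//.
  by apply: leq_trans (leq_pmull _ _); rewrite ?expn_gt0// ltn_expl.
rewrite prednK ?muln_gt0 ?expn_gt0// lognM ?expn_gt0// !lognX.
by rewrite lognE /= muln1 lognE /= muln0 addn0 choice.pickleK.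
Qed.

Lemma eventually_all (A : eqType) (s : seq A) (P : nat -> A -> Prop) :
  (forall v, exists N, forall n, (N <= n)%N -> P n v) ->
  exists N, forall n, (N <= n)%N -> forall v, v \in s -> P n v.
Proof.
move=> ev; elim: s => [|v s [N HN]]; first by exists 0%N.
have [N' HN'] := ev v; exists (maxn N N') => n.
rewrite geq_max => /andP[/HN h1 /HN' h2] u.
by rewrite inE => /orP[/eqP ->|/h1].
Qed.

Section Blocks.
Context {R : realType} {A : countType} {p : R} {hp : 1 < p}.
Local Notation X := (lp A hp).

(** The blocks of [h] do not overlap, so the [p]-th powers of their norms add up.
    As [p >= 1], the [p]-th power of [2^-(j+1)] is at most [2^-(j+1)], and these
    numbers sum to at most 1. *)
Lemma lp_sum_blocks (h : A -> R[i]) (G : nat -> X) (K : A -> nat) k0 (c : R) :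
  0 <= c ->
  (forall u, h u != 0 -> (k0 <= K u)%N /\ h u = G (K u) u) ->
  (forall j, (k0 <= j)%N -> nrm (G j) <= 2^-1 ^+ j.+1 * c) ->
  (lp_sum p h <= (c `^ p)%:E)%E.
Proof.
move=> c0 hG Gc; have p0 : 0 < p by exact: lt_trans hp.
have pN0 : p != 0 by rewrite gt_eqF.
apply: ge_ereal_sup => _ [F [finF _] <-].
rewrite fsbig_finite// sumEFin lee_fin; set s : seq A := fset_set F.
have us : uniq s by exact: fset_uniq.
pose J := \max_(u <- s) (K u).+1.
have Gp j : (k0 <= j)%N -> \sum_(u <- s) normc (G j u) `^ p <= 2^-1 ^+ j.+1 * c `^ p.
  move=> kj; apply: le_trans (_ : nrm (G j) `^ p <= _).
    rewrite -lee_fin -lp_sum_nrm -sumEFin; apply: esum_ge; exists [set` s].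
      by split=> //; exact: finite_seq.
    by rewrite -fsbig_seq.
  apply: le_trans (_ : (2^-1 ^+ j.+1 * c) `^ p <= _).
    apply: ge0_ler_powR (Gc j kj); rewrite ?nnegrE ?nrm_ge0 ?(ltW p0)//.
    by rewrite mulr_ge0 ?exprn_ge0.
  rewrite powRM ?exprn_ge0// ler_wpM2r ?powR_ge0//.
  have h1 : 2^-1 ^+ j.+1 <= 1 :> R by rewrite exprn_ile1//; lra.
  have h0 : 0 < 2^-1 ^+ j.+1 :> R by rewrite exprn_gt0.
  set x := 2^-1 ^+ j.+1 in h0 h1 *.
  have -> : x `^ p = x `^ (p - 1) * x.
    rewrite -[X in _ * X]powRr1 ?(ltW h0)// -powRD; last by rewrite (gt_eqF h0) implybT.
    by rewrite subrK.
  rewrite ler_piMl ?(ltW h0)//.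
  apply: le_trans (_ : _ <= 1 `^ (p - 1)) _; last by rewrite powR1.
  by rewrite ge0_ler_powR// ?nnegrE ?(ltW h0)// subr_ge0 ltW.
apply: le_trans (_ : \sum_(j <- iota 0 J) \sum_(u <- s)
    (if (k0 <= j)%N then normc (G j u) `^ p else 0) <= _).
  rewrite exchange_big /= big_seq [leRHS]big_seq; apply: ler_sum => u us'.
  have pos j : 0 <= (if (k0 <= j)%N then normc (G j u) `^ p else 0).
    by case: ifP => _ //; exact: powR_ge0.
  have [->|/hG[kK hE]] := eqVneq (h u) 0.
    by rewrite normc0 powR0// sumr_ge0.
  rewrite (bigD1_seq (K u)) ?iota_uniq//=; last first.
    by rewrite mem_iota /= add0n (@leq_bigmax_seq _ _ predT (fun u => (K u).+1)).
  by rewrite kK hE lerDl sumr_ge0.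
apply: le_trans (_ : \sum_(j <- iota 0 J) 2^-1 ^+ j.+1 * c `^ p <= _).
  apply: ler_sum => j _; have [kj|_] := leqP k0 j; first exact: Gp.
  by rewrite big1 ?mulr_ge0 ?exprn_ge0 ?powR_ge0.
rewrite -mulr_suml ler_piMl ?powR_ge0//.
under eq_bigr do rewrite exprS.
rewrite -mulr_sumr ler_pdivrMl// mulr1; exact: geometric_bound.
Qed.

End Blocks.

(** * The hypercyclic algebra *)

Lemma poly_disc_bound (R : realType) (Q : {poly R[i]}) :
  exists2 C : R, 0 <= C & forall z, normc z <= 1 -> normc Q.[z] <= C.
Proof.
elim/poly_ind: Q => [|Q c [C C0 HC]].
  by exists 0 => // z _; rewrite horner0 normc0.
exists (C + normc c); first by rewrite addr_ge0 ?normc_ge0.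
move=> z z1; rewrite hornerMXaddC; apply: le_trans (le_normcD _ _) _.
rewrite lerD2r normcM -[leRHS]mulr1.
by apply: ler_pM; rewrite ?normc_ge0 ?HC.
Qed.

Lemma poly_lowest_term (K : fieldType) (P : {poly K}) : P != 0 -> P.[0] = 0 ->
  exists q c Q, c != 0 /\ forall z, P.[z] = z ^+ q.+1 * (c + z * Q.[z]).
Proof.
move=> PN0 P0; have [m [P1]] := multiplicity_XsubC P 0.
rewrite PN0 /= => P1N PE; rewrite subr0 in PE.
case: m PE => [|q] PE.
  by move: P1N; rewrite /root -(mulr1 P1) -(expr0 'X) -PE P0 eqxx.
have [Q QE] : exists Q, P1 = Q * 'X + P1.[0]%:P.
  have /factor_theorem[Q QE] : root (P1 - P1.[0]%:P) 0.
    by rewrite /root hornerD hornerN hornerC subrr.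
  by exists Q; rewrite -[X in _ * X](subr0 'X) -QE subrK.
exists q, P1.[0], Q; split=> // z.
rewrite PE hornerM hornerXn mulrC; congr (_ * _).
by rewrite {1}QE hornerMXaddC addrC mulrC.
Qed.

Section DisjointDeltas.
Context {R : realType} {A : countType} {p : R} {hp : 1 < p}.
Local Notation X := (lp A hp).
Context (rho : A -> A) (rinj : injective rho) (s : seq A) (us : uniq s) (a : A -> R[i]).

Lemma sum_delta_in v : v \in s ->
  (\sum_(w <- s) a w *: delta (rho w) : X) (rho v) = a v.
Proof.
move=> vs; rewrite lp_sumrE (bigD1_seq v)// lpZ deltaE eqxx mulr1 big1 => [|w wv].
  by rewrite /= addr0.
by rewrite lpZ deltaE (inj_eq rinj) eq_sym (negPf wv) mulr0.
Qed.

Lemma sum_delta_out u : u \notin map rho s ->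
  (\sum_(w <- s) a w *: delta (rho w) : X) u = 0.
Proof.
move=> us'; rewrite lp_sumrE big_seq big1// => w ws; rewrite lpZ deltaE.
case: eqVneq => [uw|]; last by rewrite mulr0.
by move: us'; rewrite uw map_f.
Qed.

End DisjointDeltas.

Section HypercyclicAlgebra.
Context {R : realType} {A : countType} {p : R} {hp : 1 < p}.
Local Notation X := (lp A hp).
Context (E : rel A) (treeE : directed_tree E) (r : A) (rr : is_root E r).
Context (lam : A -> R[i]) (T : X -> X).
Hypotheses (BT : is_backward_shift E lam T) (bT : bounded_operator T).
Context (Lam : A -> R[i]).
Hypotheses (Lam0 : forall v, Lam v != 0)
  (LamE : forall u v, E u v -> Lam v = lam v * Lam u).
Context (M : R) (M1 : 1 <= M)
  (MB : forall n (f : X), nrm (iter n T f) <= M ^+ n * nrm f).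
Context (ray : A -> nat -> A) (rayC : forall v n, Chin E n v (ray v n))
  (rayL : forall v C, exists N, forall n, (N <= n)%N -> C <= normc (Lam (ray v n))).
Context (tgt : nat -> seq (A * (rat * rat)) * nat)
  (tgtP : forall i N, exists2 k, (N <= k)%N & tgt k = i).

Let dp := dep E r.
Let y k : X := rat_vector (tgt k).1.
Let S k := rat_support (tgt k).1.
Let q k := (tgt k).2.+1.

Let M0 : 0 < M. Proof. exact: lt_le_trans ltr01 M1. Qed.
Let Lpos v : 0 < normc (Lam v).
Proof. by rewrite lt_def normc_ge0 andbT; apply: contra_neq (Lam0 v); exact: eq0_normc. Qed.

(* The power [q k] of this coefficient, carried by [ray v n], is mapped by the
   [n]-th iterate to the value at [v] of the [k]-th target. *)
Let coef k n v : R[i] := (q k).-root (y k v * Lam v / Lam (ray v n)).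

Let coefX k n v : coef k n v ^+ q k = y k v * Lam v / Lam (ray v n).
Proof. exact: rootCK. Qed.

(** The cumulative weights tend to infinity along the rays. *)
Lemma coef_small k (e : R) : 0 < e -> exists N, forall n, (N <= n)%N ->
  forall v, v \in S k -> normc (coef k n v) <= e.
Proof.
move=> e0; apply: (@eventually_all _ _ (fun n v => normc (coef k n v) <= e)) => v.
have eq0 : 0 < e ^+ q k by rewrite exprn_gt0.
have [N HN] := rayL v (normc (y k v * Lam v) / e ^+ q k).
exists N => n /HN h.
rewrite -(ler_pXn2r (ltn0Sn (tgt k).2)) ?nnegrE ?normc_ge0 ?(ltW e0)//.
rewrite -normcX [_ ^+ _]coefX normcM normcV ler_pdivrMr// [leRHS]mulrC.
by rewrite -ler_pdivrMr.
Qed.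

(* [tau k N] absorbs the growth of [N] iterations, and [eps] is the size of the
   coefficients that keeps the norm of the block and the error terms small. *)
Let tau k N : R := 2^-1 ^+ k / M ^+ N.
Let size_bound k : R := 1 + (size (S k))%:R + \sum_(v <- S k) normc (y k v).
Let eps k N : R := 2^-1 ^+ k.+1 * tau k N / size_bound k.

Let ynorm_ge0 k : 0 <= \sum_(v <- S k) normc (y k v).
Proof. by apply: sumr_ge0 => v _; exact: normc_ge0. Qed.
Let size_bound_gt0 k : 0 < size_bound k.
Proof. by rewrite /size_bound -addrA ltr_pwDl// addr_ge0. Qed.
Let tau_gt0 k N : 0 < tau k N.
Proof. by rewrite divr_gt0 ?exprn_gt0. Qed.
Let eps_gt0 k N : 0 < eps k N.
Proof. by rewrite divr_gt0// mulr_gt0// exprn_gt0. Qed.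

Let half_le1 k : 2^-1 ^+ k <= 1 :> R.
Proof. by rewrite exprn_ile1// invf_le1// ler1n. Qed.

Let tau_le k k' N N' : (k <= k')%N -> (N <= N')%N -> tau k' N' <= tau k N.
Proof.
move=> kk NN; apply: ler_pM; rewrite ?exprn_ge0 ?invr_ge0 ?exprn_ge0 ?(ltW M0)//.
  by rewrite ler_wiXn2l// invf_le1// ler1n.
by rewrite lef_pV2 ?posrE ?exprn_gt0// ler_weXn2l.
Qed.

Let tau_le1 k N : tau k N <= 1.
Proof.
by rewrite (le_trans (tau_le (leq0n k) (leq0n N)))// /tau !expr0 divr1.
Qed.

Let eps_size k N : (size (S k))%:R * eps k N <= 2^-1 ^+ k.+1 * tau k N.
Proof.
have h := ltW (size_bound_gt0 k).
rewrite /eps mulrA ler_pdivrMr// mulrC; apply: ler_wpM2l.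
  by rewrite mulr_ge0 ?exprn_ge0 ?(ltW (tau_gt0 _ _)).
by rewrite /size_bound addrAC lerDr addr_ge0.
Qed.

Let eps_y k N : (\sum_(v <- S k) normc (y k v)) * eps k N <= 2^-1 ^+ k.+1.
Proof.
have h := ltW (size_bound_gt0 k).
rewrite /eps mulrA ler_pdivrMr// mulrC -mulrA ler_wpM2l ?exprn_ge0//.
apply: le_trans (_ : 1 * size_bound k <= _); last by rewrite mul1r.
by apply: ler_pM => //; [exact: ltW|rewrite /size_bound lerDr addr_ge0].
Qed.

Let next_ex k N : exists n, (N <= n)%N /\
  forall v, v \in S k -> normc (coef k n v) <= eps k N.
Proof.
have [N' HN'] := coef_small k (eps_gt0 k N).
by exists (maxn N N'); split; [exact: leq_maxl|apply: HN'; exact: leq_maxr].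
Qed.
Let next k N : nat := projT1 (cid (next_ex k N)).
Let nextP k N : (N <= next k N)%N /\
  forall v, v \in S k -> normc (coef k (next k N) v) <= eps k N.
Proof. by rewrite /next; case: cid. Qed.

(* The [k]-th block of the generator lies at the depths from [start k] to
   [start k.+1] excluded, and it is read off by the iterate number [time k]. *)
Let start := fix start k := if k is j.+1 then
  (next j (start j) + (\max_(v <- S j) dp v)).+1 else 0%N.
Let time k := next k (start k).

Let start_time k : (start k <= time k)%N. Proof. exact: (nextP k (start k)).1. Qed.
Let time_start k : (time k < start k.+1)%N. Proof. by rewrite /= ltnS leq_addr. Qed.
Let start_mono : {homo start : j k / (j <= k)%N}.
Proof.
apply: homo_leq => [//|? ? ? ab bc|k]; first exact: leq_trans ab bc.
exact: leq_trans (start_time k) (ltnW (time_start k)).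
Qed.
Let leq_start k : (k <= start k)%N.
Proof.
elim: k => // k IH.
exact: leq_ltn_trans (leq_trans IH (start_time k)) (time_start k).
Qed.

Let G k : X := \sum_(v <- S k) coef k (time k) v *: delta (ray v (time k)).

Let ray_inj n : injective (ray^~ n).
Proof.
move=> u v /= uv; have vC := rayC v n; rewrite -uv in vC.
exact: (Chin_inj (tree_upar treeE) (rayC u n) vC).
Qed.

Let nrmG k : nrm (G k) <= 2^-1 ^+ k.+1 * tau k (start k).
Proof.
apply: le_trans (nrm_sum _ _ _) _; apply: le_trans (eps_size k (start k)).
apply: le_trans (_ : \sum_(v <- S k) eps k (start k) <= _); last first.
  by rewrite big_const_seq count_predT iter_addr_0 mulr_natl.
rewrite big_seq [leRHS]big_seq; apply: ler_sum => v vS.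
by rewrite nrmZ nrm_delta mulr1; exact: (nextP k (start k)).2.
Qed.

Let in_block k u := (start k <= dp u < start k.+1)%N.

Let ray_block k v : v \in S k -> in_block k (ray v (time k)).
Proof.
move=> vS; rewrite /in_block /dp (dep_Chin treeE rr (rayC v (time k))).
rewrite (leq_trans (start_time k) (leq_addl _ _)) /= ltnS addnC leq_add2l.
exact: (@leq_bigmax_seq _ _ predT dp).
Qed.

Let block u : nat := xget 0%N [set k | in_block k u].

Let block_unique k j u : in_block k u -> in_block j u -> k = j.
Proof.
wlog kj : k j / (k < j)%N.
  by move=> h ku ju; have [/h->//|/h->//|//] := ltngtP k j.
move=> /andP[_ uk] /andP[ju _]; exfalso.
by have := leq_trans uk (leq_trans (start_mono kj) ju); rewrite ltnn.
Qed.

Let blockP u : in_block (block u) u.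
Proof.
rewrite /block; case: xgetP => // nob; exfalso.
have : forall k, (start k <= dp u)%N.
  elim=> // k IH; rewrite leqNgt; apply/negP => uk.
  by apply: (nob k); rewrite /= /in_block IH.
by move=> /(_ (dp u).+1)/(leq_trans (leq_start _)); rewrite ltnn.
Qed.

Let blockE k u : in_block k u -> block u = k.
Proof. by move=> ku; exact: block_unique (blockP u) ku. Qed.

Let block_ge k u : (start k <= dp u)%N -> (k <= block u)%N.
Proof.
move=> ku; rewrite leqNgt; apply/negP => bk; have /andP[_ ub] := blockP u.
by have := leq_trans ub (leq_trans (start_mono bk) ku); rewrite ltnn.
Qed.

Let x_in : (fun u => G (block u) u) \in lp_pred hp.
Proof.
rewrite inE; apply: le_lt_trans (ltry (1 `^ p)).
apply: (lp_sum_blocks (G := G) (K := block) (k0 := 0%N)) => // j _.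
by apply: le_trans (nrmG j) _; rewrite ler_wpM2l ?exprn_ge0.
Qed.
(** At a given depth, only one block can be non-zero. *)
Definition generator : X := Lp x_in.
Local Notation x := generator.

Let xE k u : in_block k u -> x u = G k u.
Proof. by move=> ku; rewrite -(blockE ku). Qed.

Let x_tail k : nrm (restr (fun u => (start k <= dp u)%N) x) <= tau k (start k).
Proof.
apply: nrm_le (ltW (tau_gt0 _ _)) _.
apply: (lp_sum_blocks (G := G) (K := block) (k0 := k)) => [|u|j kj].
- exact: ltW.
- by rewrite restrE; case: ifPn => [/block_ge kb _|]; rewrite ?eqxx.
- apply: le_trans (nrmG j) _; rewrite ler_wpM2l ?exprn_ge0// tau_le//.
  exact: start_mono.
Qed.

Let nrmx1 : nrm x <= 1.
Proof.
have -> : x = restr (fun u => (start 0 <= dp u)%N) x by apply: lp_ext.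
exact: le_trans (x_tail 0) (tau_le1 _ _).
Qed.

(** At time [time k] the earlier blocks have left the tree, and the later ones are
    so small that the growth of the iterates is compensated. In the [k]-th block,
    the lowest power of the polynomial gives [c] times the target. A higher power
    contributes an additional factor [coef], which is small: this is why the
    exponent of the root is matched with the lowest degree of [P]. *)
Lemma orbit_near_target (P Q : {poly R[i]}) (d : nat) (c : R[i]) (f : X) :
  (forall z, P.[z] = z ^+ d.+1 * (c + z * Q.[z])) -> (forall u, f u = P.[x u]) ->
  exists2 C : R, 0 <= C &
    forall k, (tgt k).2 = d -> nrm (iter (time k) T f - c *: y k) <= C * 2^-1 ^+ k.
Proof.
move=> PE fE.
have P0 : P.[0] = 0 by rewrite PE exprS !mul0r.
have [C1 C10 HQ] := poly_disc_bound Q.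
have [C2 C20 HP] : exists2 C : R, 0 <= C &
    forall z, normc z <= 1 -> normc P.[z] <= C * normc z.
  have [C C0 HC] := poly_disc_bound ('X^d * (c%:P + 'X * Q)).
  exists C => // z z1; rewrite PE exprS -mulrA normcM mulrC.
  rewrite ler_wpM2r ?normc_ge0//.
  by have := HC z z1; rewrite hornerM hornerXn hornerD hornerC hornerM hornerX.
exists (C1 + C2); first by rewrite addr_ge0.
move=> k kd; set n := time k.
pose low := restr (fun u => (dp u < start k)%N) f.
pose mid : X := \sum_(v <- S k) P.[coef k n v] *: delta (ray v n).
pose high := restr (fun u => (start k.+1 <= dp u)%N) f.
have fsplit : f = low + (mid + high).
  apply: lp_ext => u; rewrite !lpD !restrE.
  have midE : mid u = if in_block k u then f u else 0.
    have [/mapP[v vS ->]|uN] := boolP (u \in map (ray^~ n) (S k)).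
      rewrite /mid (sum_delta_in (@ray_inj n)) ?undup_uniq// (ray_block vS).
      by rewrite fE (xE (ray_block vS)) /G (sum_delta_in (@ray_inj n)) ?undup_uniq.
    rewrite /mid sum_delta_out//; case: ifPn => // ku.
    by rewrite fE (xE ku) /G sum_delta_out.
  rewrite midE /in_block; case: (ltnP (dp u) (start k)) => h1 /=.
    have -> : (start k.+1 <= dp u)%N = false.
      by apply/negbTE; rewrite -ltnNge (leq_trans h1)// start_mono.
    by rewrite !addr0.
  by case: ltnP => h2; rewrite ?add0r ?addr0.
have lowT : iter n T low = 0.
  apply: (iter_low treeE rr BT) => v nv; rewrite restrE.
  by rewrite ltnNge (leq_trans (start_time k) nv).
have midT : nrm (iter n T mid - c *: y k) <= C1 * 2^-1 ^+ k.
  rewrite {1}[y k]rat_vectorE -/(S k) scaler_sumr (iter_sum bT) -sumrB.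
  rewrite (eq_bigr (fun v => (y k v * coef k n v * Q.[coef k n v]) *: delta v)).
    apply: le_trans (nrm_sum _ _ _) _.
    apply: le_trans (_ : \sum_(v <- S k) C1 * (normc (y k v) * eps k (start k)) <= _).
      rewrite big_seq [leRHS]big_seq; apply: ler_sum => v vS.
      have cv := (nextP k (start k)).2 v vS.
      have c1 : normc (coef k n v) <= 1.
        apply: le_trans cv _; apply: le_trans (_ : size_bound k * eps k (start k) <= _).
          rewrite ler_peMl ?(ltW (eps_gt0 _ _))// /size_bound -addrA lerDl.
          by rewrite addr_ge0.
        rewrite /eps mulrC divfK ?gt_eqF// mulr_ile1 ?exprn_ge0//.
        exact: ltW.
      rewrite nrmZ nrm_delta mulr1 !normcM mulrC.
      apply: ler_pM; rewrite ?mulr_ge0 ?normc_ge0 ?HQ//.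
      by rewrite ler_wpM2l ?normc_ge0.
    rewrite -mulr_sumr ler_wpM2l// -mulr_suml; apply: le_trans (eps_y k (start k)) _.
    rewrite exprS ler_piMl ?exprn_ge0//.
    by rewrite invf_le1// ler1n.
  move=> v _; rewrite (iterZ bT) (iter_delta treeE BT bT Lam0 LamE (rayC v n)).
  rewrite !scalerA -scalerBl; congr (_ *: _).
  rewrite PE -kd -/(q k) coefX.
  by have := Lam0 v; have := Lam0 (ray v n) => h1 h2; field; rewrite h1 h2.
have highT : nrm (iter n T high) <= C2 * 2^-1 ^+ k.
  apply: le_trans (MB n high) _.
  have hh : nrm high <= C2 * tau k.+1 (start k.+1).
    apply: le_trans (_ : C2 * nrm (restr (fun u => (start k.+1 <= dp u)%N) x) <= _).
      apply: nrm_dominated => // u; rewrite !restrE; case: ifP => _; last first.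
        by rewrite normc0 mulr0.
      by rewrite fE HP// (le_trans (normc_le_nrm _ _)).
    by rewrite ler_wpM2l.
  apply: le_trans (ler_wpM2l _ hh) _; first by rewrite exprn_ge0// ltW.
  rewrite mulrCA ler_wpM2l// /tau mulrCA -[leRHS]mulr1 ler_pM ?exprn_ge0//.
  - by rewrite divr_ge0 ?exprn_ge0// ltW.
  - by rewrite exprS ler_piMl ?exprn_ge0// invf_le1// ler1n.
  - rewrite ler_pdivrMr ?exprn_gt0// mul1r; apply: ler_weXn2l => //.
    exact: ltnW (time_start k).
rewrite fsplit (iterD bT) lowT add0r (iterD bT) addrAC mulrDl.
exact: le_trans (nrmD _ _) (lerD midT highT).
Qed.

(** The targets are dense and each of them recurs, together with the lowest degree
    of [P], at arbitrarily late times, where the error of [orbit_near_target] is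
    small. *)
Lemma polynomial_hypercyclic (P : {poly R[i]}) (f : X) :
  P != 0 -> P.[0] = 0 -> (forall u, f u = P.[x u]) -> hypercyclic_vector T f.
Proof.
move=> PN0 P0 fE O [z Oz] oO.
have [d [c [Q [cN0 PE]]]] := poly_lowest_term PN0 P0.
have [C C0 HC] := orbit_near_target PE fE.
have [e e0 He] := open_nrm oO Oz.
have e20 : 0 < e / 2 by rewrite divr_gt0.
have nc : 0 < normc c.
  by rewrite lt_def normc_ge0 andbT; apply: contra_neq cN0; exact: eq0_normc.
have [|s Hs] := rat_vector_dense (c^-1 *: z) (e := e / 2 / normc c).
  by rewrite divr_gt0.
have [k Nk kE] := tgtP (s, d) (Num.truncn (C / (e / 2))).+1.
exists (iter (time k) T f); split; last by exists (time k).
apply: He; have -> : iter (time k) T f - z =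
    (iter (time k) T f - c *: y k) + (c *: y k - z) by rewrite addrA subrK.
rewrite (splitr e); apply: le_lt_trans (nrmD _ _) _; apply: ltrD.
  apply: le_lt_trans (HC k _) _; first by rewrite kE.
  rewrite exprVn ltr_pdivrMr ?exprn_gt0// mulrC -ltr_pdivrMr//.
  apply: lt_le_trans (truncnS_gt _) _.
  by rewrite -natrX ler_nat (leq_trans Nk)// ltnW// ltn_expl.
have -> : c *: y k - z = - (c *: (c^-1 *: z - y k)).
  by rewrite scalerBr scalerA mulfV// scale1r opprB.
rewrite nrmN nrmZ mulrC -(ltr_pdivlMr _ _ nc) /y kE.
exact: Hs.
Qed.

Lemma generator_neq0 : x != 0.
Proof.
apply/eqP => x0.
have hx : hypercyclic_vector T x.
  apply: (@polynomial_hypercyclic 'X); rewrite ?polyX_eq0 ?hornerX//.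
  by move=> u; rewrite hornerX.
have [|h [hr [n _ nh]]] := hx _ _ (@open_nrm_ball _ _ _ hp (delta r) 1).
  by exists (delta r); rewrite /= subrr nrm0.
move: hr; rewrite /= -nh x0 (iter0 bT) -nrmN opprB subr0 nrm_delta.
by rewrite ltxx.
Qed.

Lemma hypercyclic_algebra_exists : exists S : set X, hypercyclic_algebra T S.
Proof.
exists [set f | exists2 P : {poly R[i]}, P.[0] = 0 & forall u, f u = P.[x u]].
split.
- split.
  + by exists 0 => [|u]; rewrite horner0.
  + move=> f g [P P0 fE] [Q Q0 gE]; exists (P + Q) => [|u]; rewrite hornerD.
      by rewrite P0 Q0 addr0.
    by rewrite lpD fE gE.
  + move=> c f [P P0 fE]; exists (c *: P) => [|u]; rewrite hornerZ.
      by rewrite P0 mulr0.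
    by rewrite lpZ fE.
  + move=> f g [P P0 fE] [Q Q0 gE]; exists (P * Q) => [|u]; rewrite hornerM.
      by rewrite P0 mul0r.
    by rewrite /= fE gE.
- apply/eqP => /seteqP[/(_ x) h _]; move/eqP: generator_neq0; apply; apply: h.
  by exists 'X => [|u]; rewrite hornerX.
- move=> f [P P0 fE] fN0; apply: (polynomial_hypercyclic _ P0 fE).
  apply: contra_neq fN0 => PN0; apply: lp_ext => u.
  by rewrite fE PN0 horner0.
Qed.

End HypercyclicAlgebra.

Lemma infertile_hypercyclic_algebra (R : realType) (A : countType) (E : rel A)
    (p : R) (hp : 1 < p) (lam : A -> R[i]) (T : lp A hp -> lp A hp) :
  directed_tree E -> rooted E -> leafless E -> (forall v, ~ fertile E v) ->
  weight lam -> is_backward_shift E lam T -> bounded_operator T -> mixing T ->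
  exists S : set (lp A hp), hypercyclic_algebra T S.
Proof.
move=> treeE [r rr] lE nf lam0 BT bT mixT.
have [Lam [Lr LamE]] := tree_rec treeE rr 1 (fun v z => lam v * z).
have Lam0 : forall v, Lam v != 0.
  apply: (tree_ind treeE rr) => [|u v uv Lu]; first by rewrite Lr oner_neq0.
  by rewrite (LamE u v uv) mulf_neq0// lam0.
have [M M1 MB] := iter_bound bT.
have escape v := cid (escaping_ray treeE lE BT Lam0 LamE v mixT nf).
have [tgt tgtP] := recurrent_enumeration
  (([::], 0%N) : seq (A * (rat * rat)) * nat).
exact: (hypercyclic_algebra_exists treeE rr BT bT Lam0 LamE M1 MB
  (fun v => (projT2 (escape v)).1) (fun v => (projT2 (escape v)).2) tgtP).
Qed.

Theorem theorem5p2 (R : realType) (A : countType) (E : rel A)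
    (treeE : directed_tree E) (rootedE : rooted E) (leaflessE : leafless E)
    (p : R) (hp : 1 < p) :
  (exists lam : A -> R[i], weight lam /\
    exists T : lp A hp -> lp A hp,
      [/\ is_backward_shift E lam T,
          bounded_operator T,
          mixing T
        & ~ exists S : set (lp A hp), hypercyclic_algebra T S])
  <-> (exists v : A, fertile E v).
Proof.
split=> [[lam [lam0 [T [BT bT mixT noalg]]]]|[v fert]].
  apply: contrapT => nf; apply: noalg.
  apply: (infertile_hypercyclic_algebra treeE rootedE leaflessE _ lam0 BT bT mixT).
  by move=> v fv; apply: nf; exists v.
exact: fertile_mixing_shift treeE rootedE leaflessE fert.
Qed.
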